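(* Fix $\wp=(1,1,\vec 0)$, $\wp^*=(1,-1,\vec 0)\in\mathbb{R}^{m+4}_1$, where $\vec 0\in\mathbb{R}^{m+2}$. Then the complex stereographic projection $$\pi:[\xi]\mapsto X=\frac{-1}{2\langle\xi,\wp\rangle}\big(\langle\xi,\wp\rangle\wp^*+\langle\xi,\wp^*\rangle\wp+2\xi\big)$$ and its inverse $$\pi^{-1}:X\mapsto[\xi],\qquad \xi=\wp^*+\langle X,X\rangle\wp+2X,$$ establish a correspondence between holomorphic 1-isotropic curves in $Q^{m+2}_+\subset\mathbb{C}P^{m+3}$ and holomorphic 1-isotropic curves in $\mathbb{C}^{m+2}$. This is a one-to-one correspondence up to the choice of the poles $\wp,\wp^*$.
   Context: $\mathbb{R}^{m+4}_1$ is $\mathbb{R}^{m+4}$ with the Lorentz inner product $\langle Y,Z\rangle=-Y_0Z_0+Y_1Z_1+\cdots+Y_{m+3}Z_{m+3}$, and $\langle\cdot,\cdot\rangle$ is extended complex bilinearly to $\mathbb{C}^{m+4}_1=\mathbb{R}^{m+4}_1\otimes\mathbb{C}$. Thus $\wp,\wp^*$ are light-like with $\langle\wp,\wp^*\rangle=-2$. The space $\mathbb{C}^{m+2}$ is identified with the orthogonal complement $\{(0,0,X_1,\dots,X_{m+2})\}$ of $\{\wp,\wp^*\}$ in $\mathbb{C}^{m+4}_1$. $\mathbb{C}P^{m+3}$ is the space of complex lines in $\mathbb{C}^{m+4}_1$, and $$Q^{m+2}=\{[\xi]\in\mathbb{C}P^{m+3}:\langle\xi,\xi\rangle=0\},\qquad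 Q^{m+2}_+=\{[\xi]\in Q^{m+2}:\langle\xi,\bar\xi\rangle>0\}.$$ The domain of $\pi$ is the open dense subset of $Q^{m+2}$ where $\langle\xi,\wp\rangle\neq0$; $\pi^{-1}$ maps $\mathbb{C}^{m+2}$ into $Q^{m+2}$. A complex (holomorphic) curve in $Q^{m+2}_+$ is a holomorphic immersion $[\xi]:\overline{M^2}\to Q^{m+2}_+$ of a Riemann surface, given by local lifts $\xi$ into $\mathbb{C}^{m+4}_1$ with $\xi_{\bar z}=\lambda\xi$ for a local complex function $\lambda$ and local complex coordinate $z$; it is 1-isotropic if $d\xi$ is isotropic, i.e. $\langle\xi_z,\xi_z\rangle=0$. A vector-valued function $X:\overline{M^2}\to\mathbb{C}^{m+2}$ on a Riemann surface is holomorphic and 1-isotropic if $X_{\bar z}=0$ and $\langle X_z,X_z\rangle=0$.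
   Formalization: The bijection takes immersed curves X that are nowhere real, since at real X the point π⁻¹(X) is not in Q₊ (e.g. X=z(1,i,0,…) at z=0), and curves [ξ] with ⟨ξ,℘⟩≠0; for any curve X the non-real set is shown open and dense, and each curve in Q₊ is covered locally by some choice of poles. *)

(* Defs.v *)
From HB Require Import structures.
From mathcomp Require Import all_boot all_order all_algebra.
From mathcomp Require Import complex.
From mathcomp Require Import all_classical all_reals all_analysis.

Set Implicit Arguments.
Unset Strict Implicit.
Unset Printing Implicit Defensive.

Import Order.TTheory GRing.Theory Num.Theory.
Import numFieldNormedType.Exports.

Local Open Scope classical_set_scope.
Local Open Scope ring_scope.

(** Packing [complex R] as a [numClosedFieldType] gives it, and the row vectors
    over it, the norm topology that the library puts on such fields. *)
Definition Cplx (R : realType) : numClosedFieldType := complex R.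

(** Wirtinger derivatives.  [is_wirtinger f z a b] says that [f] is
    real-differentiable at [z] with differential [df = a dz + b d(conj z)],
    i.e. [f_z = a] and [f_(conj z) = b] at [z].  Lifts of
    curves are only required to be differentiable: the quotients of their
    components are then holomorphic, hence smooth. *)
Definition is_wirtinger (R : realType) (n : nat) (f : Cplx R -> 'rV[Cplx R]_n)
    (z : Cplx R) (a b : 'rV[Cplx R]_n) : Prop :=
  `|h|^-1 *: (f (z + h) - f z - (h *: a + h^* *: b)) @[h --> (0 : Cplx R)^']
    --> (0 : 'rV[Cplx R]_n).

Record complex_chart (R : realType) (T : topologicalType) := ComplexChart {
  chart_dom : set T ;
  chart_map : T -> Cplx R ;
  chart_inv : Cplx R -> T ;
  chart_dom_open : open chart_dom ;
  chart_img_open : open (chart_map @` chart_dom) ;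
  chart_mapK : forall x, chart_dom x -> chart_inv (chart_map x) = x ;
  chart_map_continuous : {within chart_dom, continuous chart_map} ;
  chart_inv_continuous :
    {within chart_map @` chart_dom, continuous chart_inv} }.

(** Second countability is not required: it is automatic (Rado). *)
Record riemann_surface (R : realType) := RiemannSurface {
  rs_space :> topologicalType ;
  rs_hausdorff : hausdorff_space rs_space ;
  rs_connected : connected [set: rs_space] ;
  rs_atlas : set (complex_chart R rs_space) ;
  rs_cover : forall x, exists2 c, rs_atlas c & chart_dom c x ;
  rs_holomorphic : forall c d, rs_atlas c -> rs_atlas d ->
    forall x, (chart_dom c `&` chart_dom d) x ->
    derivable (chart_map d \o chart_inv c : Cplx R -> Cplx R) (chart_map c x) 1 }.

Definition lorentz (K : comNzRingType) (n : nat) (Y Z : 'rV[K]_n) : K :=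
  \sum_j (-1) ^+ (val j == 0)%N * (Y 0 j * Z 0 j).

Definition dotC (K : comNzRingType) (n : nat) (X Y : 'rV[K]_n) : K :=
  \sum_j X 0 j * Y 0 j.

Definition complexify (R : realType) (n : nat) (Y : 'rV[R]_n) : 'rV[Cplx R]_n :=
  map_mx (fun r => real_complex R r : Cplx R) Y.

Definition conj_row (R : realType) (n : nat) (Y : 'rV[Cplx R]_n) : 'rV[Cplx R]_n :=
  map_mx Num.conj Y.

(** Points of projective space are the one-dimensional subspaces [<[xi]>%VS]
    with [xi != 0]; the quadrics are sets of such subspaces. *)
Definition quadric (R : realType) (n : nat) : set {vspace 'rV[Cplx R]_n} :=
  [set <[xi]>%VS | xi in [set xi | xi != 0 /\ lorentz xi xi = 0]].

Definition quadric_plus (R : realType) (n : nat) : set {vspace 'rV[Cplx R]_n} :=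
  [set <[xi]>%VS |
    xi in [set xi | [/\ xi != 0, lorentz xi xi = 0
                      & 0 < lorentz xi (conj_row xi)]]].

Section CurvesInProjectiveSpace.
Variables (R : realType) (M : riemann_surface R) (n : nat).
Implicit Types (U : set M) (G : M -> {vspace 'rV[Cplx R]_n}).

(** A lift [xi] of [G] over the open set [W] of the coordinate plane of [c]
    with [xi_(conj z) = l xi] for some complex function [l]. *)
Definition local_lift U G (c : complex_chart R M) (W : set (Cplx R))
    (xi : Cplx R -> 'rV[Cplx R]_n) : Prop :=
  [/\ rs_atlas c, open W, W `<=` chart_map c @` (chart_dom c `&` U)
    & forall z, W z ->
      [/\ xi z != 0, G (chart_inv c z) = <[xi z]>%VS
        & exists a l, is_wirtinger xi z a (l *: xi z)]].

Definition holomorphic_CP U G : Prop :=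
  forall c x, rs_atlas c -> (chart_dom c `&` U) x ->
  exists W xi, W (chart_map c x) /\ local_lift U G c W xi.

Definition isotropic_CP U G : Prop :=
  forall c W xi, local_lift U G c W xi -> forall z, W z ->
  forall a b, is_wirtinger xi z a b -> lorentz a a = 0.

(** The tangent space of projective space at [xi] is [Hom(<xi>, C^n / <xi>)],
    so the differential of [xi] induces that of [G] modulo the line [<xi>]. *)
Definition immersion_CP U G : Prop :=
  forall c W xi, local_lift U G c W xi -> forall z, W z ->
  forall a b, is_wirtinger xi z a b ->
  forall h : Cplx R, h *: a + h^* *: b \in <[xi z]>%VS -> h = 0.

Definition isotropic_curve_CP U G : Prop :=
  [/\ holomorphic_CP U G, isotropic_CP U G & immersion_CP U G].

End CurvesInProjectiveSpace.

Section CurvesInVectorSpace.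
Variables (R : realType) (M : riemann_surface R) (n : nat).
Variable form : 'rV[Cplx R]_n -> 'rV[Cplx R]_n -> Cplx R.
Implicit Types (U : set M) (X : M -> 'rV[Cplx R]_n).

Definition holomorphic_vec U X : Prop :=
  forall c x, rs_atlas c -> (chart_dom c `&` U) x ->
  exists a, is_wirtinger (X \o chart_inv c) (chart_map c x) a 0.

Definition isotropic_vec U X : Prop :=
  forall c x, rs_atlas c -> (chart_dom c `&` U) x ->
  forall a b, is_wirtinger (X \o chart_inv c) (chart_map c x) a b ->
  form a a = 0.

Definition immersion_vec U X : Prop :=
  forall c x, rs_atlas c -> (chart_dom c `&` U) x ->
  forall a b, is_wirtinger (X \o chart_inv c) (chart_map c x) a b ->
  forall h : Cplx R, h *: a + h^* *: b = 0 -> h = 0.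

Definition isotropic_curve_vec U X : Prop :=
  [/\ holomorphic_vec U X, isotropic_vec U X & immersion_vec U X].

End CurvesInVectorSpace.

Section StereographicProjection.
Variables (R : realType) (n : nat).
Implicit Types (p q : 'rV[R]_n) (xi X : 'rV[Cplx R]_n).

Definition pole_pair p q : Prop :=
  [/\ lorentz p p = 0, lorentz q q = 0 & lorentz p q = - 2].

Definition polar_complement p q : set 'rV[Cplx R]_n :=
  [set X | lorentz X (complexify p) = 0 /\ lorentz X (complexify q) = 0].

Definition pole_domain p : set {vspace 'rV[Cplx R]_n} :=
  [set <[xi]>%VS |
    xi in [set xi | lorentz xi xi = 0 /\ lorentz xi (complexify p) != 0]].

Definition stereo_formula p q xi : 'rV[Cplx R]_n :=
  (- 1 / (2 * lorentz xi (complexify p))) *: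
    (lorentz xi (complexify p) *: complexify q
     + lorentz xi (complexify q) *: complexify p + 2 *: xi).

Definition stereo_inv_formula p q X : 'rV[Cplx R]_n :=
  complexify q + lorentz X X *: complexify p + 2 *: X.

(** [vpick L] is a generator of the line [L]; the formula does not depend on
    the choice of the generator. *)
Definition stereo p q (L : {vspace 'rV[Cplx R]_n}) : 'rV[Cplx R]_n :=
  stereo_formula p q (vpick L).

Definition stereo_inv p q X : {vspace 'rV[Cplx R]_n} :=
  <[stereo_inv_formula p q X]>%VS.

End StereographicProjection.

Section StandardPoles.
Variables (R : realType) (m : nat).

Definition wp : 'rV[R]_(2 + m.+2) := row_mx (const_mx 1) 0.

Definition wpstar : 'rV[R]_(2 + m.+2) :=
  row_mx (\row_(j < 2) (-1) ^+ val j) 0.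

Definition embed (X : 'rV[Cplx R]_(m.+2)) : 'rV[Cplx R]_(2 + m.+2) := row_mx 0 X.

(** Complex stereographic projection with poles [wp], [wpstar], read in
    [C^(m+2)] through [embed]; meaningful on [pole_domain wp]. *)
Definition std_stereo (L : {vspace 'rV[Cplx R]_(2 + m.+2)}) : 'rV[Cplx R]_(m.+2) :=
  rsubmx (stereo wp wpstar L).

Definition std_stereo_inv (X : 'rV[Cplx R]_(m.+2)) :
    {vspace 'rV[Cplx R]_(2 + m.+2)} :=
  stereo_inv wp wpstar (embed X).

End StandardPoles.

(* Main.v *)
From HB Require Import structures.
From mathcomp Require Import all_boot all_order all_algebra.
From mathcomp Require Import complex ring.
From mathcomp Require Import all_classical all_reals all_analysis.
Require Import Defs.

Set Implicit Arguments.
Unset Strict Implicit.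
Unset Printing Implicit Defensive.

Import Order.TTheory GRing.Theory Num.Theory.
Import numFieldNormedType.Exports.

Local Open Scope classical_set_scope.
Local Open Scope ring_scope.

(** Both maps are given by formulas: with P, Q the complexified poles,
    [w = <xi, P>] and [v = <xi, Q>], the projection is
    [pi xi = - (Q + (v / w) P + (2 / w) xi) / 2] and its inverse is
    [X |-> Q + <X, X> P + 2 X].  Bilinearity, [<P, P> = <Q, Q> = 0] and
    [<P, Q> = - 2] give that they are inverse to each other between the
    isotropic lines with [w != 0] and the complement of P and Q
    ([stereo_invK], [stereoK]).  For X in that complement, the Hermitian square
    of the representative of [pi^-1 X] is [- 2 <X - conj X, X - conj X>]
    ([stereo_inv_hermitian]), which for the standard poles is a positive
    multiple of the squared length of the imaginary part of X; this identifies
    the part of [C^(m+2)] that lies over [Q_+].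

    For curves everything follows from one computation.  Let [xi] be a local
    lift, [a = xi_z] and [xi_(conj z) = l xi], and let [X = pi xi].  As [pi] is
    holomorphic and constant on lines, [X_(conj z)] vanishes
    ([wirtinger_stereo]).  Differentiating [<xi, xi> = 0] gives [<xi, a> = 0],
    and then [<X_z, X_z> = <a, a> / w^2] ([stereo_deriv_norm]), while [X_z]
    vanishes exactly when [a] is a multiple of [xi] ([stereo_deriv_eq0]).
    Holomorphy, isotropy and immersivity of [xi] and of [X] are therefore
    equivalent; [local_lift_stereo] collects these facts, and in the other
    direction [pi^-1 X] has a lift that is holomorphic.  The statement for
    curves in [C^(m+2)] is the one for the complement of the standard poles,
    carried over by the isometry [embed].

    The curve [pi^-1 X] lies in [Q_+] on a dense set because a holomorphic X
    that is real on an open set satisfies [X_z = conj (X_(conj z)) = 0] there,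
    which an immersion cannot do ([nonreal_dense]).  Finally the vectors
    [e_0 + s e_j] with [j != 0] and [s = 1] or [s = - 1] span the space, so
    one of them is a pole that is not orthogonal to a given nonzero vector
    ([exists_pole_pair]).

    Real differentiability is handled through the form of Caratheodory:
    [f (z + h) = f z + h u(h) + conj(h) v(h)] with u, v tending to the two
    Wirtinger derivatives, which turns the rules of calculus into algebra. *)

(** * The Lorentz form and complex conjugation *)

Section LorentzForm.
Variables (K : comNzRingType) (n : nat).
Implicit Types (X Y Z : 'rV[K]_n) (c : K).

Lemma lorentzC X Y : lorentz X Y = lorentz Y X.
Proof. by apply: eq_bigr => j _; rewrite (mulrC (X 0 j)). Qed.

Lemma lorentzDl X Y Z : lorentz (X + Y) Z = lorentz X Z + lorentz Y Z.
Proof.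
by rewrite -big_split; apply: eq_bigr => j _; rewrite !mxE mulrDl mulrDr.
Qed.

Lemma lorentzZl c X Y : lorentz (c *: X) Y = c * lorentz X Y.
Proof.
by rewrite /lorentz mulr_sumr; apply: eq_bigr => j _; rewrite !mxE; ring.
Qed.

Lemma lorentzDr X Y Z : lorentz X (Y + Z) = lorentz X Y + lorentz X Z.
Proof. by rewrite lorentzC lorentzDl !(lorentzC X). Qed.

Lemma lorentzZr c X Y : lorentz X (c *: Y) = c * lorentz X Y.
Proof. by rewrite lorentzC lorentzZl (lorentzC X). Qed.

Lemma lorentz0l X : lorentz 0 X = 0.
Proof. by rewrite -(scale0r X) lorentzZl mul0r. Qed.

Lemma lorentzNl X Y : lorentz (- X) Y = - lorentz X Y.
Proof. by rewrite -scaleN1r lorentzZl mulN1r. Qed.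

Lemma lorentzNr X Y : lorentz X (- Y) = - lorentz X Y.
Proof. by rewrite lorentzC lorentzNl lorentzC. Qed.

Definition lorentz_lin := (lorentzDl, lorentzDr, lorentzZl, lorentzZr,
  lorentzNl, lorentzNr).

End LorentzForm.

Lemma lorentz_map (K L : comNzRingType) (f : {rmorphism K -> L}) n
    (X Y : 'rV[K]_n) : lorentz (map_mx f X) (map_mx f Y) = f (lorentz X Y).
Proof.
rewrite /lorentz rmorph_sum; apply: eq_bigr => j _.
by rewrite !mxE !rmorphM rmorphXn rmorphN1.
Qed.

Section Conjugation.
Variables (R : realType) (n : nat).
Implicit Types (X Y : 'rV[Cplx R]_n) (p : 'rV[R]_n).

Lemma lorentz_complexify p q :
  lorentz (complexify p) (complexify q) = real_complex R (lorentz p q) :> Cplx R.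
Proof. exact: (lorentz_map (real_complex R)). Qed.

Lemma lorentz_conj X Y :
  lorentz (conj_row X) (conj_row Y) = (lorentz X Y)^*.
Proof. exact: lorentz_map. Qed.

Lemma conj_rowD X Y : conj_row (X + Y) = conj_row X + conj_row Y.
Proof. by apply/rowP => j; rewrite !mxE rmorphD. Qed.

Lemma conj_rowZ (c : Cplx R) X : conj_row (c *: X) = c^* *: conj_row X.
Proof. by apply/rowP => j; rewrite !mxE rmorphM. Qed.

Lemma conj_complexify p : conj_row (complexify p) = complexify p.
Proof.
apply/rowP => j; rewrite !mxE; apply: conj_Creal.
by rewrite complex_real.
Qed.

End Conjugation.

(** * Lines and stereographic projection *)

Section Lines.
Variables (K : fieldType) (n : nat).
Implicit Types x y : 'rV[K]_n.

Lemma line_eqP x y : x != 0 -> <[x]>%VS = <[y]>%VS ->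
  exists2 c : K, c != 0 & x = c *: y.
Proof.
move=> x0 xy; have /vlineP[c xE] : x \in <[y]>%VS by rewrite -xy memv_line.
by exists c => //; apply: contraNneq x0 => c0; rewrite xE c0 scale0r.
Qed.

Lemma line_scale (c : K) x : c != 0 -> <[c *: x]>%VS = <[x]>%VS.
Proof.
move=> c0; apply/eqP; rewrite eqEsubv -!memvE rpredZ ?memv_line //=.
by apply/vlineP; exists c^-1; rewrite scalerA mulVf ?scale1r.
Qed.

(** The projection is defined on a line through its picked generator; this
    compares that generator with any other one. *)
Lemma vpick_line x : x != 0 -> exists2 c : K, c != 0 & vpick <[x]>%VS = c *: x.
Proof.
move=> x0; have /vlineP[c cE] := memv_pick <[x]>%VS.
exists c => //; apply: contraNneq x0 => c0.
have := vpick0 <[x]>%VS; rewrite cE c0 scale0r eqxx => /esym/eqP x0.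
by rewrite -memv0 -x0 memv_line.
Qed.

End Lines.

Section Stereographic.
Variables (R : realType) (n : nat) (p q : 'rV[R]_n).
Hypothesis pq : pole_pair p q.
Implicit Types (xi X : 'rV[Cplx R]_n) (L : {vspace 'rV[Cplx R]_n}).

Let P := complexify p.
Let Q := complexify q.

Lemma pole_pairC : [/\ lorentz P P = 0, lorentz Q Q = 0,
  lorentz P Q = - 2 & lorentz Q P = - 2].
Proof.
have [pp qq pqE] := pq; rewrite !lorentz_complexify pp qq pqE (lorentzC q) pqE.
by rewrite !raddf0 raddfN /= rmorph_nat.
Qed.

Let PP : lorentz P P = 0. Proof. by have [] := pole_pairC. Qed.
Let QQ : lorentz Q Q = 0. Proof. by have [] := pole_pairC. Qed.
Let PQ : lorentz P Q = - 2. Proof. by have [] := pole_pairC. Qed.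
Let QP : lorentz Q P = - 2. Proof. by have [] := pole_pairC. Qed.

Lemma stereo_inv_formula_pole X : polar_complement p q X ->
  lorentz (stereo_inv_formula p q X) P = - 2.
Proof. by case=> XP XQ; rewrite !lorentz_lin QP PP XP; ring. Qed.

Lemma stereo_inv_isotropic X : polar_complement p q X ->
  lorentz (stereo_inv_formula p q X) (stereo_inv_formula p q X) = 0.
Proof.
case=> XP XQ; rewrite !lorentz_lin !(lorentzC _ X) -/P -/Q.
by rewrite PP QQ PQ QP XP XQ; ring.
Qed.

Lemma stereo_inv_formula_neq0 X : polar_complement p q X ->
  stereo_inv_formula p q X != 0.
Proof.
move=> /stereo_inv_formula_pole XP; apply: contra_eq_neq XP => ->.
by rewrite lorentz0l eq_sym oppr_eq0.
Qed.

(** Homogeneity of degree 0 makes the projection well defined on lines. *)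
Lemma stereo_formulaZ (c : Cplx R) xi : c != 0 ->
  stereo_formula p q (c *: xi) = stereo_formula p q xi.
Proof.
move=> c0; rewrite /stereo_formula !lorentzZl; apply/rowP => j; rewrite !mxE.
by rewrite !invfM; move: (lorentz xi _)^-1 => v; field.
Qed.

Lemma stereo_formula_polar xi : lorentz xi P != 0 ->
  polar_complement p q (stereo_formula p q xi).
Proof.
by move=> w0; split; rewrite !lorentz_lin -/P -/Q ?PP ?QQ ?PQ ?QP; field.
Qed.

Lemma stereo_inv_formulaK X : polar_complement p q X ->
  stereo_formula p q (stereo_inv_formula p q X) = X.
Proof.
move=> PX; have [XP XQ] := PX.
rewrite /stereo_formula stereo_inv_formula_pole //.
have -> : lorentz (stereo_inv_formula p q X) (complexify q)
    = - 2 * lorentz X X.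
  by rewrite !lorentz_lin -/P -/Q QQ PQ XQ; ring.
by apply/rowP => j; rewrite !mxE; field.
Qed.

(** With [X] the projection of [xi], this is the value of [<X, X>] that the
    inverse formula needs to recover the P-component of [xi]. *)
Lemma stereo_formula_norm xi : lorentz xi xi = 0 -> lorentz xi P != 0 ->
  lorentz (stereo_formula p q xi) (stereo_formula p q xi)
  = lorentz xi Q / lorentz xi P.
Proof.
move=> xi0 w0; rewrite !lorentz_lin !(lorentzC _ xi) -/P -/Q PP QQ PQ QP xi0.
by field.
Qed.

Lemma stereo_formulaK xi : lorentz xi xi = 0 -> lorentz xi P != 0 ->
  stereo_inv_formula p q (stereo_formula p q xi) = (- 2 / lorentz xi P) *: xi.
Proof.
move=> xi0 w0; rewrite /stereo_inv_formula stereo_formula_norm //.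
by apply/rowP => j; rewrite !mxE -/P; field.
Qed.

(** The two conditions are homogeneous, so any generator may be tested. *)
Lemma pole_domain_line xi : pole_domain p <[xi]>%VS <->
  lorentz xi xi = 0 /\ lorentz xi P != 0.
Proof.
split=> [[zeta [zz zP] zxi]|]; last by move=> ?; exists xi.
have z0 : zeta != 0 by apply: contraNneq zP => ->; rewrite lorentz0l.
have [c c0 zE] := line_eqP z0 zxi.
move: zz zP; rewrite zE lorentzZl lorentzZr lorentzZl !mulf_eq0 !negb_or.
by move/eqP; rewrite !mulf_eq0 !(negPf c0) /= => /eqP -> ->.
Qed.

Lemma stereo_line xi : xi != 0 -> stereo p q <[xi]>%VS = stereo_formula p q xi.
Proof.
by move=> /vpick_line[c c0 cE]; rewrite /stereo cE stereo_formulaZ.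
Qed.

Lemma stereo_polar L : pole_domain p L -> polar_complement p q (stereo p q L).
Proof.
case=> xi [xi0 w0] <-; rewrite stereo_line; first exact: stereo_formula_polar.
by apply: contraNneq w0 => ->; rewrite lorentz0l.
Qed.

Lemma stereo_inv_domain X : polar_complement p q X ->
  pole_domain p (stereo_inv p q X).
Proof.
move=> PX; apply/pole_domain_line; split; first exact: stereo_inv_isotropic.
by rewrite stereo_inv_formula_pole // oppr_eq0.
Qed.

Lemma stereo_invK X : polar_complement p q X -> stereo p q (stereo_inv p q X) = X.
Proof.
move=> PX; rewrite stereo_line ?stereo_inv_formula_neq0 //.
exact: stereo_inv_formulaK.
Qed.

Lemma stereoK L : pole_domain p L -> stereo_inv p q (stereo p q L) = L.
Proof.
case=> xi [xi0 w0] <-; rewrite stereo_line; last first.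
  by apply: contraNneq w0 => ->; rewrite lorentz0l.
rewrite /stereo_inv stereo_formulaK // line_scale //.
by rewrite mulf_neq0 ?invr_eq0 // oppr_eq0.
Qed.

Lemma quadric_plus_line xi : @quadric_plus R n <[xi]>%VS <->
  [/\ xi != 0, lorentz xi xi = 0 & 0 < lorentz xi (conj_row xi)].
Proof.
split=> [[zeta [z0 zz zP] zxi]|]; last by move=> ?; exists xi.
have [c c0 zE] := line_eqP z0 zxi.
move: z0 zz zP; rewrite zE scaler_eq0 negb_or c0 conj_rowZ => /= xi0.
rewrite !lorentz_lin => /eqP; rewrite !mulf_eq0 (negPf c0) /= => /eqP -> zP.
split=> //; move: zP; rewrite mulrA -normCK pmulr_rgt0 //.
by rewrite exprn_gt0 // normr_gt0.
Qed.

Lemma polar_complement_conj X : polar_complement p q X ->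
  polar_complement p q (conj_row X).
Proof.
by case=> XP XQ; split; rewrite -conj_complexify lorentz_conj ?XP ?XQ rmorph0.
Qed.

(** As P and Q are real, the Hermitian square of [pi^-1 X] expands to
    [4 <X, conj X> - 2 <X, X> - 2 <conj X, conj X>]. *)
Lemma stereo_inv_hermitian X : polar_complement p q X ->
  let D := X - conj_row X in
  lorentz (stereo_inv_formula p q X) (conj_row (stereo_inv_formula p q X))
  = - 2 * lorentz D D.
Proof.
move=> PX D; have [XP XQ] := PX; have [YP YQ] := polar_complement_conj PX.
rewrite /D /stereo_inv_formula !conj_rowD !conj_rowZ !conj_complexify.
rewrite -lorentz_conj rmorph_nat.
move: (conj_row X) YP YQ => Y YP YQ.
rewrite !lorentz_lin !(lorentzC _ X) !(lorentzC _ Y) -/P -/Q (lorentzC Y X).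
by rewrite PP QQ PQ QP XP XQ YP YQ; ring.
Qed.

End Stereographic.

(** * Wirtinger calculus *)

Section Convergence.
Variables (K : numClosedFieldType) (T : Type) (F : set_system T).
Context {FF : Filter F}.

Lemma cvg_coord n (u : T -> 'rV[K]_n) (a : 'rV[K]_n) j :
  u @ F --> a -> u x 0 j @[x --> F] --> a 0 j.
Proof.
move=> ua; apply: (@cvg_comp _ _ _ u (fun M : 'rV[K]_n => M 0 j) F
  (nbhs a)) => //.
exact: coord_continuous.
Qed.

Lemma cvg_sum (V : normedModType K) n (f : 'I_n -> T -> V) (l : 'I_n -> V) :
  (forall j, f j @ F --> l j) -> \sum_j f j x @[x --> F] --> \sum_j l j.
Proof.
move=> fl; have := @cvg_big V 'I_n +%R 0 xpredT (@tvs.add_continuous V) T F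
  (index_enum 'I_n) f l FF; apply => j _; exact: fl.
Qed.

Lemma cvg_lorentz n (u v : T -> 'rV[K]_n) (a b : 'rV[K]_n) :
  u @ F --> a -> v @ F --> b -> lorentz (u x) (v x) @[x --> F] --> lorentz a b.
Proof.
move=> ua vb; rewrite /lorentz.
apply: (@cvg_sum K) => j; apply: cvgM; first exact: cvg_cst.
by apply: cvgM; exact: cvg_coord.
Qed.

Lemma cvg_linear n (V : normedModType K) (L : {linear 'rV[K]_n -> V})
    (u : T -> 'rV[K]_n) (a : 'rV[K]_n) : u @ F --> a -> L (u x) @[x --> F] --> L a.
Proof.
move=> ua; have LE v : L v = \sum_j v 0 j *: L (delta_mx 0 j).
  rewrite {1}(row_sum_delta v) linear_sum.
  by apply: eq_bigr => j _; rewrite linearZ.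
rewrite LE; under eq_cvg do rewrite LE.
apply: cvg_sum => j.
by apply: cvgZr_tmp; exact: cvg_coord.
Qed.

Lemma cvg_conj (u : T -> K) (a : K) : u @ F --> a -> (u x)^* @[x --> F] --> a^*.
Proof.
move=> ua; apply/cvgrPdist_lt => e e0.
near=> x; rewrite -rmorphB norm_conjC; near: x.
by move/cvgrPdist_lt : ua; apply.
Unshelve. all: by end_near. Qed.

(** Nonreal numbers are the complement of the closed set where [a = conj a]. *)
Lemma near_Im_neq0 (u : T -> K) (a : K) :
  u @ F --> a -> 'Im a != 0 -> \forall x \near F, 'Im (u x) != 0.
Proof.
move=> ua ima.
have a0 : a - a^* != 0.
  apply: contra_neq ima => /subr0_eq aa; apply/Creal_ImP; exact/CrealP/esym.
have lim : u x - (u x)^* @[x --> F] --> a - a^*.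
  by apply: cvgB => //; exact: cvg_conj.
move: lim => /cvgr_neq0 /(_ a0); apply: filterS => x.
by apply: contra_neq => /Creal_ImP/CrealP ->; rewrite subrr.
Qed.

Lemma cvg_map_conj n (u : T -> 'rV[K]_n) (a : 'rV[K]_n) :
  u @ F --> a -> map_mx Num.conj (u x) @[x --> F] --> map_mx Num.conj a.
Proof.
move=> ua.
have conjE (v : 'rV[K]_n) : map_mx Num.conj v = \sum_j (v 0 j)^* *: delta_mx 0 j.
  rewrite (row_sum_delta (map_mx Num.conj v)).
  by apply: eq_bigr => j _; rewrite mxE.
rewrite conjE; under eq_cvg do rewrite conjE.
apply: (@cvg_sum 'rV[K]_n) => j.
apply: cvgZr_tmp; apply: cvg_conj.
exact: cvg_coord.
Qed.

End Convergence.

Section Wirtinger.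
Variable K : numClosedFieldType.

(** The form of Caratheodory of real differentiability: [u] and [v] are
    difference quotients with limits [f_z] and [f_(conj z)].  They are not
    unique, but their limits are. *)
Definition wirtinger (V : normedModType K) (f : K -> V) (z : K) (a b : V) :=
  exists u v : K -> V,
  [/\ u h @[h --> (0 : K)^'] --> a, v h @[h --> (0 : K)^'] --> b
    & \forall h \near (0 : K)^',
        f (z + h) = f z + (h *: u h + h^* *: v h)].

(** From the little-o form, the whole remainder is put into the coefficient of
    [h]; conversely [h / |h|] and [conj h / |h|] have modulus 1. *)
Lemma wirtinger_littleo n (f : K -> 'rV[K]_n) z a b :
  (`|h|^-1 *: (f (z + h) - f z - (h *: a + h^* *: b)) @[h --> (0 : K)^']
    --> (0 : 'rV[K]_n)) <-> wirtinger f z a b.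
Proof.
split=> [fab|[u [v [ua vb fE]]]].
  pose r h := f (z + h) - f z - (h *: a + h^* *: b).
  exists (fun h => a + h^-1 *: r h), (cst b); split; last 1 first.
  - near=> h; have h0 : h != 0 by near: h; exact: nbhs_dnbhs_neq.
    rewrite scalerDr scalerA divff // scale1r addrAC.
    by rewrite [h *: a + _ + _]addrC subrK [RHS]addrC subrK.
  - rewrite -[X in _ --> X]addr0; apply: cvgD; first exact: cvg_cst.
    apply: norm_cvg0; move: fab => /norm_cvg0P.
    have rE h : `|h^-1 *: r h| = `| `|h|^-1 *: r h|.
      by rewrite !normrZ !normfV normr_id.
    by move=> fab; under eq_cvg do rewrite rE.
  - exact: cvg_cst.
have unit_cvg (c : K -> K) (w : K -> 'rV[K]_n) :
    (\forall h \near (0 : K)^', `|c h| = `|h|) ->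
    w h @[h --> (0 : K)^'] --> (0 : 'rV[K]_n) ->
    `|h|^-1 *: (c h *: w h) @[h --> (0 : K)^'] --> (0 : 'rV[K]_n).
  move=> cE w0; apply: norm_cvg0; move/norm_cvg0P : w0.
  apply: cvg_trans; apply: near_eq_cvg; near=> h.
  have h0 : h != 0 by near: h; exact: nbhs_dnbhs_neq.
  have hE : `|c h| = `|h| by near: h.
  by rewrite !normrZ hE normfV normr_id mulKf // normr_eq0.
have ua0 : (fun h => u h - a) h @[h --> (0 : K)^'] --> (0 : 'rV[K]_n).
  rewrite -(subrr a).
  exact: (@cvgB _ 'rV[K]_n _ _ _ u (cst a) a a ua (cvg_cst a)).
have vb0 : (fun h => v h - b) h @[h --> (0 : K)^'] --> (0 : 'rV[K]_n).
  rewrite -(subrr b).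
  exact: (@cvgB _ 'rV[K]_n _ _ _ v (cst b) b b vb (cvg_cst b)).
have idh : \forall h \near (0 : K)^', `|id h| = `|h| by near=> h.
have conjh : \forall h \near (0 : K)^', `|Num.conj h| = `|h|.
  by near=> h; rewrite norm_conjC.
have uv0 : (fun h => `|h|^-1 *: (h *: (u h - a)) +
      `|h|^-1 *: (h^* *: (v h - b)))
    h @[h --> (0 : K)^'] --> (0 : 'rV[K]_n).
  have := cvgD (unit_cvg id _ idh ua0) (unit_cvg Num.conj _ conjh vb0).
  by rewrite addr0; apply.
apply: cvg_trans uv0.
apply: (@near_eq_cvg K 'rV[K]_n (0 : K)^' _).
near=> h.
have -> : f (z + h) = f z + (h *: u h + h^* *: v h) by near: h.
rewrite -scalerDr; congr (_ *: _); rewrite [f z + _]addrC addrK.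
by rewrite !scalerBr opprD addrACA.
Unshelve. all: by end_near. Qed.

Variable V : normedModType K.
Implicit Types (f g : K -> V) (s : K -> K) (a b : V) (z : K).

Lemma wirtinger_near f g z a b : (\forall x \near z, f x = g x) ->
  wirtinger f z a b -> wirtinger g z a b.
Proof.
move=> fg [u [v [ua vb fE]]]; exists u, v; split=> //.
have fgz : \forall h \near (0 : K)^', f (z + h) = g (z + h).
  by apply: nbhs_dnbhs; move/nbhs0P : fg.
near=> h; rewrite -(nbhs_singleton fg).
have <- : f (z + h) = g (z + h) by near: h.
by near: h.
Unshelve. all: by end_near. Qed.

Lemma cvg_id_dnbhs0 : h @[h --> (0 : K)^'] --> (0 : K).
Proof. by apply: cvg_trans (@cvg_id _ (nbhs (0 : K))); exact: nbhs_dnbhs. Qed.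

Lemma cvg_conj_dnbhs0 : h^* @[h --> (0 : K)^'] --> (0 : K).
Proof. by have := cvg_conj cvg_id_dnbhs0; rewrite rmorph0; apply. Qed.

Lemma wirtinger_cvg f z a b : wirtinger f z a b ->
  f (z + h) @[h --> (0 : K)^'] --> f z.
Proof.
move=> [u [v [ua vb fE]]].
have lim : f z + (h *: u h + h^* *: v h) @[h --> (0 : K)^'] --> f z.
  rewrite -[X in _ --> X]addr0; apply: cvgD; first exact: cvg_cst.
  rewrite -[X in _ --> X]addr0; apply: cvgD.
    by rewrite -(scale0r a); apply: cvgZ ua; exact: cvg_id_dnbhs0.
  by rewrite -(scale0r b); apply: cvgZ vb; exact: cvg_conj_dnbhs0.
apply: cvg_trans lim; apply: near_eq_cvg.
by apply: filterS fE => h ->.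
Qed.

Lemma wirtinger_continuous f z a b : wirtinger f z a b -> f x @[x --> z] --> f z.
Proof.
move=> /wirtinger_cvg fz.
apply/(@cvgrPdist_lt K V K (nbhs z) (nbhs_filter z)) => e e0.
have := (iffLR (cvgrPdist_lt _ _)) fz e e0; rewrite near_withinE => fze.
apply: (iffRL (nbhs0P [set t | `|f z - f t| < e] z)).
near=> h => /=; have [->|h0] := eqVneq h 0.
  by rewrite addr0 subrr normr0.
by move: h0; near: h; exact: fze.
Unshelve. all: by end_near. Qed.

Lemma wirtinger_cst a z : wirtinger (cst a) z 0 0.
Proof.
exists (cst 0), (cst 0); split; do ?exact: cvg_cst.
by near=> h; rewrite !scaler0 !addr0.
Unshelve. all: by end_near. Qed.

Lemma wirtingerD f g z a b c d : wirtinger f z a b -> wirtinger g z c d ->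
  wirtinger (fun x => f x + g x) z (a + c) (b + d).
Proof.
move=> [u [v [ua vb fE]]] [u' [v' [uc vd gE]]].
exists (fun h => u h + u' h), (fun h => v h + v' h); split; do ?exact: cvgD.
near=> h; have -> : f (z + h) = f z + (h *: u h + h^* *: v h) by near: h.
have -> : g (z + h) = g z + (h *: u' h + h^* *: v' h) by near: h.
by rewrite !scalerDr addrACA; congr (_ + _); rewrite addrACA.
Unshelve. all: by end_near. Qed.

Lemma wirtingerZ s f z (c d : K) a b :
  wirtinger (V := K) s z c d -> wirtinger f z a b ->
  wirtinger (fun x => s x *: f x) z (c *: f z + s z *: a) (d *: f z + s z *: b).
Proof.
move=> [u' [v' [uc vd sE]]] fab; have fz := wirtinger_cvg fab.
case: fab => [u [v [ua vb fE]]].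
exists (fun h => u' h *: f (z + h) + s z *: u h),
  (fun h => v' h *: f (z + h) + s z *: v h); split.
- by apply: cvgD; [exact: cvgZ | apply: cvgZ => //; exact: cvg_cst].
- by apply: cvgD; [exact: cvgZ | apply: cvgZ => //; exact: cvg_cst].
near=> h; have -> : s (z + h) = s z + (h * u' h + h^* * v' h) by near: h.
have fzh : f (z + h) = f z + (h *: u h + h^* *: v h) by near: h.
rewrite scalerDl {1}fzh !scalerDr !scalerDl !scalerA ![_ * s z]mulrC -addrA.
by congr (_ + _); rewrite addrACA; congr (_ + _); rewrite addrC.
Unshelve. all: by end_near. Qed.

(** Along the real direction [h = |h|] only [a + b] is seen, along the
    imaginary direction [h = 'i |h|] only [a - b]. *)
Lemma wirtinger_uniq f z a b a' b' :
  wirtinger f z a b -> wirtinger f z a' b' -> a = a' /\ b = b'.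
Proof.
move=> [u [v [ua vb fE]]] [u' [v' [ua' vb' fE']]].
have E : \forall h \near (0 : K)^', h *: (u h - u' h) = h^* *: (v' h - v h).
  near=> h.
  have : f z + (h *: u h + h^* *: v h) = f z + (h *: u' h + h^* *: v' h).
    have <- : f (z + h) = f z + (h *: u h + h^* *: v h) by near: h.
    by near: h.
  move/addrI/eqP; rewrite -subr_eq0 => /eqP uv; apply: subr0_eq; rewrite -uv.
  by rewrite !scalerBr !opprD !opprK [RHS]addrACA; congr (_ + _); rewrite addrC.
(* comparing the two expansions along [h = c * `|h|] *)
have dir (c : K) : `|c| = 1 -> c *: (a - a') = c^* *: (b' - b).
  move=> c1; have c0 : c != 0 by rewrite -normr_eq0 c1 oner_eq0.
  have to0 : c * `|h| @[h --> (0 : K)^'] --> (0 : K)^'.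
    move=> A A0.
    have lim : c * `|h| @[h --> (0 : K)] --> (0 : K).
      have := cvgM (cvg_cst c) (@norm_continuous K K 0).
      by rewrite normr0 mulr0; apply.
    have A1 : \forall h \near (0 : K), c * `|h| != 0 -> A (c * `|h|) := lim _ A0.
    apply: filterS2 (nbhs_dnbhs_neq (0 : K)) (nbhs_dnbhs A1) => h h0.
    by apply; rewrite mulf_neq0 // normr_eq0.
  have comp (w : K -> V) (l : V) : w h @[h --> (0 : K)^'] --> l ->
      w (c * `|h|) @[h --> (0 : K)^'] --> l.
    move=> wl; exact: (@cvg_comp _ _ _ (fun h : K => c * `|h|) w _ _ _ to0 wl).
  have lim_l : c *: (u (c * `|h|) - u' (c * `|h|)) @[h --> (0 : K)^']
      --> c *: (a - a').
    apply: cvgZ; first exact: cvg_cst.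
    by apply: cvgB; [exact: comp ua | exact: comp ua'].
  have lim_r : c^* *: (v' (c * `|h|) - v (c * `|h|)) @[h --> (0 : K)^']
      --> c^* *: (b' - b).
    apply: cvgZ; first exact: cvg_cst.
    by apply: cvgB; [exact: comp vb' | exact: comp vb].
  apply: (cvg_unique _ lim_l); first exact: norm_hausdorff.
  apply: cvg_trans lim_r; apply: near_eq_cvg.
  have := to0 _ E; rewrite /= near_simpl => Ec; near=> h.
  have h0 : `|h| != 0.
    by rewrite normr_eq0; near: h; exact: nbhs_dnbhs_neq.
  have : (c * `|h|) *: (u (c * `|h|) - u' (c * `|h|)) =
      (c * `|h|)^* *: (v' (c * `|h|) - v (c * `|h|)) by near: h.
  rewrite (_ : (c * `|h|)^* = `|h| * c^*); last first.
    by rewrite rmorphM /= conj_normC mulrC.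
  rewrite [c * `|h|]mulrC -!scalerA.
  by move/(scalerI h0).
have := dir 1 (normr1 _); rewrite rmorph1 !scale1r => aE.
have := dir 'i (normCi _); rewrite conjCi scaleNr -scalerN => /scalerI bE.
have {}bE := bE (neq0Ci _).
have /eqP : 2 *: (a - a') = 0.
  by rewrite scaler_nat mulr2n {1}aE bE addrN.
rewrite scaler_eq0 pnatr_eq0 /= subr_eq0 => /eqP aa'; split=> //.
by move/eqP : aE; rewrite aa' subrr eq_sym subr_eq0 => /eqP.
Unshelve. all: by end_near. Qed.

End Wirtinger.

Section WirtingerRow.
Variable K : numClosedFieldType.

Lemma wirtingerV (s : K -> K) z (c d : K) : s z != 0 -> wirtinger (V := K) s z c d ->
  wirtinger (V := K) (fun x => (s x)^-1) z (- c / s z ^+ 2) (- d / s z ^+ 2).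
Proof.
move=> sz0 scd; have sz := wirtinger_cvg scd.
case: scd => [u [v [uc vd sE]]].
have inv_cvg : - (s z * s (z + h))^-1 @[h --> (0 : K)^'] --> - (s z ^+ 2)^-1.
  apply: cvgN; apply: cvgV; first by rewrite expf_neq0.
  by rewrite expr2; apply: cvgM => //; exact: cvg_cst.
exists (fun h => u h * - (s z * s (z + h))^-1),
  (fun h => v h * - (s z * s (z + h))^-1); split.
- by rewrite mulNr -mulrN; apply: cvgM.
- by rewrite mulNr -mulrN; apply: cvgM.
near=> h; have szh : s (z + h) = s z + (h * u h + h^* * v h) by near: h.
have szh0 : s (z + h) != 0.
  by near: h; move: sz0; apply: cvgr_neq0.
rewrite -![_ *: _]/(_ * _) !mulrA -mulrDl.
have -> : h * u h + h^* * v h = s (z + h) - s z by rewrite szh [RHS]addrC addKr.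
by field; rewrite sz0 szh0.
Unshelve. all: by end_near. Qed.

Lemma wirtinger_linear n (V : normedModType K) (L : {linear 'rV[K]_n -> V})
    (f : K -> 'rV[K]_n) z a b :
  wirtinger f z a b -> wirtinger (fun x => L (f x)) z (L a) (L b).
Proof.
move=> [u [v [ua vb fE]]].
exists (fun h => L (u h)), (fun h => L (v h)); split; do ?exact: cvg_linear.
by apply: filterS fE => h ->; rewrite !linearD !linearZ.
Qed.

Lemma wirtinger_lorentz n (f g : K -> 'rV[K]_n) z a b c d :
  wirtinger f z a b -> wirtinger g z c d ->
  wirtinger (V := K) (fun x => lorentz (f x) (g x)) z
    (lorentz a (g z) + lorentz (f z) c) (lorentz b (g z) + lorentz (f z) d).
Proof.
move=> fab [u' [v' [uc vd gE]]]; have fz := wirtinger_cvg fab.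
case: fab => [u [v [ua vb fE]]].
exists (fun h => lorentz (u h) (g z) + lorentz (f (z + h)) (u' h)),
  (fun h => lorentz (v h) (g z) + lorentz (f (z + h)) (v' h)); split.
- by apply: cvgD; apply: cvg_lorentz => //; exact: cvg_cst.
- by apply: cvgD; apply: cvg_lorentz => //; exact: cvg_cst.
near=> h; have -> : g (z + h) = g z + (h *: u' h + h^* *: v' h) by near: h.
have fzh : f (z + h) = f z + (h *: u h + h^* *: v h) by near: h.
rewrite !lorentzDr !lorentzZr {1}fzh !lorentz_lin.
rewrite -[h *: (_ + _ : K)]/(h * _) -[h^* *: (_ + _ : K)]/(h^* * _).
by ring.
Unshelve. all: by end_near. Qed.

(** Conjugation exchanges the coefficients of [h] and [conj h]. *)
Lemma wirtinger_conj n (f : K -> 'rV[K]_n) z a b : wirtinger f z a b ->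
  wirtinger (fun x => map_mx Num.conj (f x)) z (map_mx Num.conj b) (map_mx Num.conj a).
Proof.
move=> [u [v [ua vb fE]]].
exists (fun h => map_mx Num.conj (v h)), (fun h => map_mx Num.conj (u h)).
split; do ?exact: cvg_map_conj.
apply: filterS fE => h ->; rewrite !map_mxD !map_mxZ /= conjCK.
by congr (_ + _); rewrite addrC.
Qed.

End WirtingerRow.

Lemma is_wirtingerP (R : realType) n (f : Cplx R -> 'rV[Cplx R]_n)
  z a b : is_wirtinger f z a b <-> wirtinger f z a b.
Proof. exact: wirtinger_littleo. Qed.

(** * Charts *)

Section Charts.
Variables (R : realType) (T : topologicalType) (c : complex_chart R T).

Lemma chart_map_cvg x : chart_dom c x ->
  chart_map c y @[y --> x] --> chart_map c x.
Proof.
move=> cx; have := @chart_map_continuous _ _ c.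
rewrite continuous_open_subspace; last exact: chart_dom_open.
by apply; rewrite inE.
Qed.

Lemma chart_inv_cvg x : chart_dom c x ->
  chart_inv c z @[z --> chart_map c x] --> x.
Proof.
move=> cx; have := @chart_inv_continuous _ _ c.
rewrite continuous_open_subspace; last exact: chart_img_open.
have zx : chart_map c x \in chart_map c @` chart_dom c.
  by rewrite inE; exists x.
by move=> /(_ _ zx); rewrite /continuous_at chart_mapK.
Qed.

Lemma chart_near x (A : set T) : chart_dom c x -> nbhs x A ->
  \forall z \near chart_map c x,
    (chart_map c @` (chart_dom c `&` A)) z /\ A (chart_inv c z).
Proof.
move=> cx Ax.
have A' : \forall z \near chart_map c x, A (chart_inv c z).
  exact: (chart_inv_cvg cx Ax).
have c' : \forall z \near chart_map c x, (chart_map c @` chart_dom c) z.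
  by apply: open_nbhs_nbhs; split; [exact: chart_img_open | exists x].
apply: filterS2 A' c' => z Az [y cy yz]; split=> //; exists y => //; split=> //.
by move: Az; rewrite -yz chart_mapK.
Qed.

Lemma chart_image_open (U : set T) : open U ->
  open (chart_map c @` (chart_dom c `&` U)).
Proof.
move=> oU; rewrite openE => _ [x [cx Ux] <-].
have := chart_near cx (open_nbhs_nbhs (conj oU Ux)).
by apply: filterS => z [].
Qed.

End Charts.

(** * The derivative of stereographic projection *)

Section StereographicDerivative.
Variables (K : numClosedFieldType) (n : nat) (P Q : 'rV[K]_n).
Hypothesis PP : lorentz P P = 0.

(** The z-derivative of the constant [<xi, xi>] is [2 <xi, xi_z>]. *)
Lemma wirtinger_isotropic (xi : K -> 'rV[K]_n) z a b :
  wirtinger xi z a b -> (\forall x \near z, lorentz (xi x) (xi x) = 0) ->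
  lorentz (xi z) a = 0.
Proof.
move=> xia xixi; have xixia := wirtinger_lorentz xia xia.
have c0 : \forall x \near z, lorentz (xi x) (xi x) = cst 0 x by [].
have [] := wirtinger_uniq (wirtinger_near c0 xixia) (wirtinger_cst 0 z).
rewrite (lorentzC a) -mulr2n -mulr_natl => /eqP.
by rewrite mulf_eq0 pnatr_eq0 /= => /eqP.
Qed.

Lemma wirtinger_eq (f : K -> 'rV[K]_n) z a b a' b' : a = a' -> b = b' ->
  wirtinger f z a b -> wirtinger f z a' b'.
Proof. by move=> -> ->. Qed.

(** The differential at [xi] of the projection from P, applied to [a], with the
    quotients differentiated and the terms collected. *)
Definition stereo_deriv (xi a : 'rV[K]_n) : 'rV[K]_n :=
  let w := lorentz xi P in
  (- ((lorentz a Q * w - lorentz xi Q * lorentz a P) / (2 * w ^+ 2))) *: P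
  + (lorentz a P / w ^+ 2) *: xi - w^-1 *: a.

(** The conj-z-derivative vanishes because the projection is invariant under
    scaling and [xi_(conj z)] is tangent to the line of [xi]. *)
Lemma wirtinger_stereo (xi : K -> 'rV[K]_n) z a l :
  wirtinger xi z a (l *: xi z) -> lorentz (xi z) P != 0 ->
  wirtinger (fun x => (- 1 / (2 * lorentz (xi x) P)) *:
      (lorentz (xi x) P *: Q + lorentz (xi x) Q *: P + 2 *: xi x)) z
    (stereo_deriv (xi z) a) 0.
Proof.
move=> xia w0.
have wP := wirtinger_lorentz xia (wirtinger_cst P z).
have wQ := wirtinger_lorentz xia (wirtinger_cst Q z).
have w := wirtingerD (wirtingerD (wirtingerZ wP (wirtinger_cst Q z))
  (wirtingerZ wQ (wirtinger_cst P z)))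
  (wirtingerZ (wirtinger_cst (V := K) 2 z) xia).
have := wirtingerZ (wirtinger_cst (V := K) (- 1 / 2) z)
  (wirtingerZ (wirtingerV (s := fun x => lorentz (xi x) P) w0 wP) w).
(* [wirtingerV] differentiates [w^-1]; the constant factor is split off *)
have E : \forall x \near z, cst (- 1 / 2 : K) x *: ((lorentz (xi x) P)^-1 *:
    (lorentz (xi x) P *: Q + lorentz (xi x) Q *: P + (2 : K) *: xi x)) =
    (- 1 / (2 * lorentz (xi x) P)) *:
      (lorentz (xi x) P *: Q + lorentz (xi x) Q *: P + 2 *: xi x).
  by near=> x; rewrite scalerA invfM mulrA.
move=> /(wirtinger_near E); apply: wirtinger_eq.
- rewrite /stereo_deriv /cst /= !(lorentzC _ 0) !lorentz0l.
  by apply/rowP => j; rewrite !mxE; field.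
- rewrite /cst /= !(lorentzC _ 0) !lorentz0l !lorentzZl.
  by apply/rowP => j; rewrite !mxE; field.
Unshelve. all: by end_near. Qed.

Section Tangent.
Variables xi a : 'rV[K]_n.
Hypotheses (xi0 : lorentz xi xi = 0) (xia : lorentz xi a = 0).
Hypothesis w0 : lorentz xi P != 0.

(** The components along P and [xi] do not contribute: P, [xi] and [a] are
    isotropic or orthogonal as needed, and the mixed terms that contain
    [<a, P>] and [<xi, P>] cancel. *)
Lemma stereo_deriv_norm : lorentz (stereo_deriv xi a) (stereo_deriv xi a)
  = lorentz a a / lorentz xi P ^+ 2.
Proof.
rewrite /stereo_deriv !lorentz_lin (lorentzC a xi) !(lorentzC P) xi0 xia.
by rewrite PP; field.
Qed.

(** The kernel of the differential is the tangent of the scaling; pairing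
    with [xi] first removes the component along P. *)
Lemma stereo_deriv_eq0 : stereo_deriv xi a = 0 <-> a \in <[xi]>%VS.
Proof.
split=> [d0|/vlineP[t ->]]; last first.
  by rewrite /stereo_deriv !lorentzZl; apply/rowP => j; rewrite !mxE; field.
(* only the P-component survives in the product with [xi] *)
have : lorentz xi (stereo_deriv xi a) = 0 by rewrite d0 lorentzC lorentz0l.
rewrite {1}/stereo_deriv !lorentz_lin xi0 xia !mulr0 addr0 subr0 => /eqP.
rewrite mulf_eq0 (negPf w0) orbF oppr_eq0 => /eqP c0.
move: d0; rewrite /stereo_deriv c0 oppr0 scale0r add0r => /subr0_eq aE.
apply/vlineP; exists (lorentz xi P * (lorentz a P / lorentz xi P ^+ 2)).
by rewrite -scalerA aE scalerA divff // scale1r.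
Qed.

End Tangent.

(** The inverse is a polynomial in X alone, so it preserves holomorphy. *)
Lemma wirtinger_stereo_inv (X : K -> 'rV[K]_n) z a : wirtinger X z a 0 ->
  exists b, wirtinger (fun x => Q + lorentz (X x) (X x) *: P + 2 *: X x) z b 0.
Proof.
move=> Xa; eexists.
have := wirtingerD (wirtingerD (wirtinger_cst Q z)
  (wirtingerZ (wirtinger_lorentz Xa Xa) (wirtinger_cst P z)))
  (wirtingerZ (wirtinger_cst (V := K) 2 z) Xa).
apply: wirtinger_eq; first by [].
by rewrite /cst /= !(lorentzC _ 0) !lorentz0l !(addr0, scaler0, scale0r).
Qed.

End StereographicDerivative.

(** * Curves and their projections *)

Section Curves.
Variables (R : realType) (M : riemann_surface R) (n : nat).
Implicit Types (U V : set M) (G : M -> {vspace 'rV[Cplx R]_n}).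
Implicit Types (Y : M -> 'rV[Cplx R]_n).

Lemma local_lift_sub U V G c W xi : V `<=` U ->
  local_lift V G c W xi -> local_lift U G c W xi.
Proof.
move=> VU [rc oW WV Wxi]; split=> // z /WV[x [cx Vx] xz].
by exists x => //; split=> //; exact: VU.
Qed.

(** Lifts over a smaller set are lifts over the larger one, so isotropy and
    immersivity restrict; holomorphy needs lifts over smaller domains. *)
Lemma isotropic_curve_CP_sub U V G : open V -> V `<=` U ->
  isotropic_curve_CP U G -> isotropic_curve_CP V G.
Proof.
move=> oV VU [hG iG mG]; split.
- move=> c x rc [cx Vx].
  have [W [xi [Wx [_ oW WU Wxi]]]] := hG c x rc (conj cx (VU _ Vx)).
  exists (W `&` chart_map c @` (chart_dom c `&` V)), xi; split.
    by split=> //; exists x.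
  split=> //.
  - by apply: openI => //; exact: chart_image_open.
  - by move=> z [Wz _]; exact: Wxi.
- by move=> c W xi /(local_lift_sub VU); exact: iG.
- by move=> c W xi /(local_lift_sub VU); exact: mG.
Qed.

Lemma isotropic_curve_vec_sub form U V Y : V `<=` U ->
  isotropic_curve_vec form U Y -> isotropic_curve_vec form V Y.
Proof.
by move=> VU [hY iY mY]; split=> c x rc [cx /VU Ux];
  [exact: hY | exact: iY | exact: mY].
Qed.

Lemma is_wirtinger_near (f g : Cplx R -> 'rV[Cplx R]_n) z a b :
  (\forall x \near z, f x = g x) -> is_wirtinger f z a b -> is_wirtinger g z a b.
Proof.
move=> fg /is_wirtingerP fab.
by apply/is_wirtingerP; exact: wirtinger_near fab.
Qed.

Lemma is_wirtinger_uniq (f : Cplx R -> 'rV[Cplx R]_n) z a b a' b' :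
  is_wirtinger f z a b -> is_wirtinger f z a' b' -> a = a' /\ b = b'.
Proof.
move=> /is_wirtingerP fab /is_wirtingerP.
exact: wirtinger_uniq.
Qed.

Lemma isotropic_curve_vec_ext form V Y Y' : open V ->
  (forall x, V x -> Y x = Y' x) ->
  isotropic_curve_vec form V Y -> isotropic_curve_vec form V Y'.
Proof.
move=> oV YY'.
have near_eq (c : complex_chart R M) x : (chart_dom c `&` V) x ->
    \forall z \near chart_map c x, (Y \o chart_inv c) z = (Y' \o chart_inv c) z.
  move=> [cx Vx]; apply: filterS (chart_near cx (open_nbhs_nbhs (conj oV Vx))).
  by move=> z [_ Vz]; exact: YY'.
have near_eq' (c : complex_chart R M) x : (chart_dom c `&` V) x ->
    \forall z \near chart_map c x, (Y' \o chart_inv c) z = (Y \o chart_inv c) z.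
  by move=> /near_eq; apply: filterS.
move=> [hY iY mY]; split=> c x rc cVx.
- have [a aY] := hY c x rc cVx; exists a.
  exact: is_wirtinger_near (near_eq _ _ cVx) aY.
- move=> a b /(is_wirtinger_near (near_eq' _ _ cVx)); exact: iY.
- move=> a b /(is_wirtinger_near (near_eq' _ _ cVx)); exact: mY.
Qed.

Section Poles.
Variables p q : 'rV[R]_n.
Hypothesis pq : pole_pair p q.
Let P := complexify p.
Let Q := complexify q.

(** The condition [<xi, P> != 0] is open for a continuous lift [xi], and lying
    in the quadric supplies the isotropy of the line. *)
Lemma pole_domain_open U G : open U ->
  (forall x, U x -> @quadric_plus R n (G x)) -> holomorphic_CP U G ->
  open (U `&` G @^-1` pole_domain p).
Proof.
move=> oU GQ hG; rewrite openE => x [Ux Gx].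
have [c rc cx] := rs_cover x.
have [W [xi [Wx [_ oW WU Wxi]]]] := hG c x rc (conj cx Ux).
have [xix0 GxE [a [l /is_wirtingerP xia]]] := Wxi _ Wx.
move: Gx; rewrite /= -{1}(chart_mapK cx) GxE pole_domain_line -/P => -[_ w0].
have lim := wirtinger_continuous (wirtinger_lorentz xia (wirtinger_cst P _)).
have near_w : \forall z \near chart_map c x, lorentz (xi z) P != 0.
  by move: lim => /cvgr_neq0; apply.
have nearM : \forall y \near x, [/\ chart_dom c y, U y, W (chart_map c y)
    & lorentz (xi (chart_map c y)) P != 0].
  have near_W : \forall y \near x, W (chart_map c y).
    by apply: (chart_map_cvg cx); apply: open_nbhs_nbhs; split.
  have near_w' : \forall y \near x, lorentz (xi (chart_map c y)) P != 0.
    exact: (chart_map_cvg cx near_w).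
  near=> y; split; near: y => //.
  - by apply: open_nbhs_nbhs; split=> //; exact: chart_dom_open.
  - by apply: open_nbhs_nbhs; split.
apply: filterS nearM => y [cy Uy Wy wy]; split=> //=.
have [_ GyE _] := Wxi _ Wy; have := GQ y Uy.
rewrite -{1 2}(chart_mapK cy) GyE => /quadric_plus_line[_ xi0 _].
exact/pole_domain_line.
Unshelve. all: by end_near. Qed.

(** The bridge between a curve of lines and its projection: it computes the
    derivative of the projected curve from that of any lift. *)
Lemma local_lift_stereo U G c W xi z :
  (forall x, U x -> pole_domain p (G x)) -> local_lift U G c W xi -> W z ->
  exists a l aX,
  [/\ is_wirtinger xi z a (l *: xi z),
      is_wirtinger (stereo p q \o G \o chart_inv c) z aX 0,
      lorentz (xi z) P != 0,
      lorentz aX aX = lorentz a a / lorentz (xi z) P ^+ 2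
    & aX = 0 <-> a \in <[xi z]>%VS].
Proof.
move=> GP [rc oW WU Wxi] Wz.
have xiP x : W x -> lorentz (xi x) (xi x) = 0 /\ lorentz (xi x) P != 0.
  move=> Wx; apply/pole_domain_line; have [_ <- _] := Wxi _ Wx.
  by have [y [cy Uy] <-] := WU _ Wx; rewrite chart_mapK //; exact: GP.
have nearW : \forall x \near z, W x by apply: open_nbhs_nbhs; split.
have [xi0 _ [a [l xia]]] := Wxi _ Wz; have [xixi w0] := xiP _ Wz.
have xia' := (iffLR (is_wirtingerP _ _ _ _)) xia.
have xiaE : lorentz (xi z) a = 0.
  by apply: wirtinger_isotropic xia' _; apply: filterS nearW => x /xiP[].
have [PP _ _ _] := pole_pairC pq.
exists a, l, (stereo_deriv P Q (xi z) a).
split; [exact: xia| |exact: w0| |].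
- apply/is_wirtingerP.
  apply: wirtinger_near (wirtinger_stereo Q xia' w0).
  apply: filterS nearW => x Wx; have [xix0 GxE _] := Wxi _ Wx.
  by rewrite /= GxE stereo_line.
- exact: stereo_deriv_norm.
- exact: stereo_deriv_eq0.
Qed.

Lemma stereo_holomorphic U G : (forall x, U x -> pole_domain p (G x)) ->
  holomorphic_CP U G -> holomorphic_vec U (stereo p q \o G).
Proof.
move=> GP hG c x rc cUx; have [W [xi [Wx xiG]]] := hG c x rc cUx.
have [a [l [aX [_ XaX _ _ _]]]] := local_lift_stereo GP xiG Wx.
by exists aX.
Qed.

Lemma local_lift_at U G c W xi z : local_lift U G c W xi -> W z ->
  exists2 x, (chart_dom c `&` U) x & chart_map c x = z.
Proof. by move=> [_ _ WU _] /WU[x]; exists x. Qed.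

Lemma stereo_isotropic U G : (forall x, U x -> pole_domain p (G x)) ->
  holomorphic_CP U G -> isotropic_CP U G <->
  isotropic_vec (@lorentz (Cplx R) n) U (stereo p q \o G).
Proof.
move=> GP hG; split=> [iG c x rc cUx a b Xab|iX c W xi xiG z Wz a b xiab].
  have [W [xi [Wx xiG]]] := hG c x rc cUx.
  have [a' [l [aX [xia XaX w0 E _]]]] := local_lift_stereo GP xiG Wx.
  have [-> _] := is_wirtinger_uniq Xab XaX.
  by rewrite E (iG c W xi xiG _ Wx _ _ xia) mul0r.
have [x cUx xz] := local_lift_at xiG Wz.
have [a' [l [aX [xia XaX w0 /esym/eqP]]]] := local_lift_stereo GP xiG Wz.
have [-> _] := is_wirtinger_uniq xiab xia.
have aX0 : lorentz aX aX = 0.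
  by case: xiG => rc _ _ _; move: XaX; rewrite -xz; exact: iX.
by rewrite aX0 mulf_eq0 invr_eq0 expf_eq0 /= (negPf w0) orbF => /eqP + _.
Qed.

Lemma stereo_immersion U G : (forall x, U x -> pole_domain p (G x)) ->
  holomorphic_CP U G -> immersion_CP U G <-> immersion_vec U (stereo p q \o G).
Proof.
move=> GP hG; split=> [mG c x rc cUx a b Xab h|mX c W xi xiG z Wz a b xiab h].
  have [W [xi [Wx xiG]]] := hG c x rc cUx.
  have [a' [l [aX [xia XaX w0 _ E]]]] := local_lift_stereo GP xiG Wx.
  have [-> ->] := is_wirtinger_uniq Xab XaX.
  rewrite scaler0 addr0 => /eqP; rewrite scaler_eq0 => /orP[/eqP//|/eqP/E a'xi].
  apply: (mG c W xi xiG _ Wx _ _ xia).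
  by rewrite rpredD // rpredZ // rpredZ // memv_line.
have [x cUx xz] := local_lift_at xiG Wz.
have [a' [l [aX [xia XaX w0 _ E]]]] := local_lift_stereo GP xiG Wz.
have [-> ->] := is_wirtinger_uniq xiab xia.
rewrite rpredDr; last by rewrite rpredZ // rpredZ // memv_line.
rewrite rpredZeq => /orP[/eqP//|/E aX0].
case: xiG => rc _ _ _; move: XaX; rewrite -xz aX0 => XaX.
by apply: (mX c x rc cUx _ _ XaX); rewrite !scaler0 addr0.
Qed.

Lemma stereo_isotropic_curve U G : (forall x, U x -> pole_domain p (G x)) ->
  isotropic_curve_CP U G ->
  isotropic_curve_vec (@lorentz (Cplx R) n) U (stereo p q \o G).
Proof.
move=> GP [hG iG mG]; split; first exact: stereo_holomorphic.
  exact/stereo_isotropic.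
exact/stereo_immersion.
Qed.

Section InverseProjection.
Variable Y : M -> 'rV[Cplx R]_n.
Hypothesis YP : forall x, polar_complement p q (Y x).

Lemma stereo_inv_comp : stereo p q \o (stereo_inv p q \o Y) = Y.
Proof. by apply/funext => x /=; rewrite stereo_invK. Qed.

Let GP U x : U x -> pole_domain p ((stereo_inv p q \o Y) x).
Proof. by move=> _; exact: stereo_inv_domain. Qed.

(** The lift of [pi^-1 Y] given by the formula is itself holomorphic, that is
    [xi_(conj z) = l xi] with [l = 0]. *)
Lemma stereo_inv_holomorphic U : open U ->
  holomorphic_vec U Y <-> holomorphic_CP U (stereo_inv p q \o Y).
Proof.
move=> oU; split=> [hY c x rc cUx|/(stereo_holomorphic (@GP U))]; last first.
  by rewrite stereo_inv_comp.
exists (chart_map c @` (chart_dom c `&` U)).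
exists (stereo_inv_formula p q \o Y \o chart_inv c); split; first by exists x.
split=> //; first exact: chart_image_open.
move=> _ [y cUy <-]; split=> //; first exact: stereo_inv_formula_neq0.
have [a /is_wirtingerP Ya] := hY c y rc cUy.
have [b Yb] := wirtinger_stereo_inv P Q Ya.
by exists b, 0; rewrite scale0r; apply/is_wirtingerP.
Qed.

Lemma stereo_inv_isotropic_curves U : open U ->
  (holomorphic_vec U Y /\ isotropic_vec (@lorentz (Cplx R) n) U Y) <->
  (holomorphic_CP U (stereo_inv p q \o Y) /\
   isotropic_CP U (stereo_inv p q \o Y)).
Proof.
move=> oU; split=> -[hY iY].
  have hG := (iffLR (stereo_inv_holomorphic oU)) hY.
  by split=> //; apply/(stereo_isotropic (@GP U) hG); rewrite stereo_inv_comp.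
split; first exact/stereo_inv_holomorphic.
by move/(stereo_isotropic (@GP U) hY) : iY; rewrite stereo_inv_comp.
Qed.

Lemma stereo_inv_immersion U : open U -> holomorphic_vec U Y ->
  immersion_vec U Y <-> immersion_CP U (stereo_inv p q \o Y).
Proof.
move=> oU /(stereo_inv_holomorphic oU) hG.
by rewrite (stereo_immersion (@GP U) hG) stereo_inv_comp.
Qed.

Lemma stereo_inv_isotropic_curve U : open U ->
  isotropic_curve_vec (@lorentz (Cplx R) n) U Y ->
  isotropic_curve_CP U (stereo_inv p q \o Y).
Proof.
move=> oU [hY iY mY].
have [hG iG] := (iffLR (stereo_inv_isotropic_curves oU)) (conj hY iY).
by split=> //; apply/stereo_inv_immersion.
Qed.

End InverseProjection.

Lemma stereo_comp G : (forall x, pole_domain p (G x)) ->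
  stereo_inv p q \o (stereo p q \o G) = G.
Proof. by move=> GP; apply/funext => x /=; rewrite stereoK. Qed.

Lemma stereo_bij_curves :
  set_bij
    [set G | (forall x, @quadric_plus R n (G x) /\ pole_domain p (G x)) /\
      isotropic_curve_CP setT G]
    [set Y | (forall x, polar_complement p q (Y x) /\
                        @quadric_plus R n (stereo_inv p q (Y x))) /\
      isotropic_curve_vec (@lorentz (Cplx R) n) setT Y]
    (fun G => stereo p q \o G).
Proof.
split.
- move=> G [/= GQ iG]; split=> [x|]; last first.
    by apply: stereo_isotropic_curve => // x _; have [] := GQ x.
  have [Q1 Q2] := GQ x; split; first exact: stereo_polar.
  by rewrite /= stereoK.
- move=> G G' /set_mem[GQ _] /set_mem[GQ' _] /= GG'.
  apply: etrans (esym (stereo_comp (fun x => (GQ x).2))) _.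
  apply: etrans (stereo_comp (fun x => (GQ' x).2)).
  exact: (congr1 (fun Y => stereo_inv p q \o Y) GG').
- move=> Y [/= YQ iY]; have YP x := (YQ x).1.
  exists (stereo_inv p q \o Y); last exact: stereo_inv_comp.
  split=> [x|] /=; last exact: stereo_inv_isotropic_curve openT iY.
  by split; [have [] := YQ x | exact: stereo_inv_domain].
Qed.

End Poles.

End Curves.

(** * The standard poles *)

Section StandardPoles.
Variables (R : realType) (m : nat).
Let K := Cplx R.
Implicit Types X Y : 'rV[K]_(m.+2).

Lemma lorentz_row (F : comNzRingType) (a b : 'rV[F]_2) (X Y : 'rV[F]_(m.+2)) :
  lorentz (row_mx a X) (row_mx b Y) =
  - (a 0 0 * b 0 0) + a 0 1 * b 0 1 + dotC X Y.
Proof.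
rewrite /lorentz big_split_ord /= big_ord_recl big_ord1; congr (_ + _).
  congr (_ + _); rewrite !row_mxEl /=; first by rewrite expr1 mulN1r.
  rewrite expr0 mul1r; congr (a _ _ * b _ _); exact/val_inj.
by apply: eq_bigr => j _; rewrite !row_mxEr /= expr0 mul1r.
Qed.

Lemma lorentz_embed X Y : lorentz (embed X) (embed Y) = dotC X Y.
Proof. by rewrite lorentz_row !mxE !mul0r oppr0 !add0r. Qed.

Lemma standard_pole_pair : pole_pair (wp R m) (wpstar R m).
Proof.
split; rewrite lorentz_row !mxE /dotC big1 ?addr0 => *; rewrite ?mxE ?mul0r //=.
- by ring.
- by rewrite expr0 expr1; ring.
- by rewrite expr0 expr1; ring.
Qed.

Lemma complexify_row n1 n2 (a : 'rV[R]_n1) (b : 'rV[R]_n2) :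
  complexify (row_mx a b) = row_mx (complexify a) (complexify b).
Proof. exact: map_row_mx. Qed.

Lemma polar_embed X : polar_complement (wp R m) (wpstar R m) (embed X).
Proof.
split; rewrite complexify_row lorentz_row !mxE !mul0r oppr0 !add0r;
  by apply: big1 => j _; rewrite !mxE raddf0 mulr0.
Qed.

(** Orthogonality to [(1, 1)] and [(1, - 1)] kills the first two coordinates. *)
Lemma embed_rsubmx (X : 'rV[K]_(2 + m.+2)) :
  polar_complement (wp R m) (wpstar R m) X -> embed (rsubmx X) = X.
Proof.
have := hsubmxK X; move: (lsubmx X) => a XE.
rewrite -{1 2}XE => -[]; rewrite !complexify_row !lorentz_row.
have dot0 Y : dotC Y (complexify 0) = 0.
  by apply: big1 => j _; rewrite !mxE raddf0 mulr0.
rewrite !dot0 !mxE /= expr0 expr1 raddfN !rmorph1 !addr0 !mulr1 mulrN1.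
move=> ap aq; rewrite /embed -[RHS]XE; congr row_mx; last by rewrite XE.
have a0 : a 0 0 = 0.
  (* the sum of the two orthogonality relations is [- 2 a_0 = 0] *)
  have : a 0 0 *+ 2 = - ((- a 0 0 + a 0 1) + (- a 0 0 - a 0 1)) by ring.
  rewrite ap aq addr0 oppr0.
  by move/eqP; rewrite mulrn_eq0 /= => /eqP.
have a1 : a 0 1 = 0 by move: ap; rewrite a0 oppr0 add0r.
apply/rowP => j; rewrite mxE; case: (split_ordP (j : 'I_(1 + 1))) => i ->.
  by rewrite ord1 -[LHS]a0; congr (a _ _); exact/val_inj.
by rewrite ord1 -[LHS]a1; congr (a _ _); exact/val_inj.
Qed.

Lemma range_embed :
  range (@embed R m) = polar_complement (wp R m) (wpstar R m).
Proof.
apply/seteqP; split=> [_ [X _ <-]|X PX]; first exact: polar_embed.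
by exists (rsubmx X) => //; exact: embed_rsubmx.
Qed.

Lemma embed_std_stereo L : pole_domain (wp R m) L ->
  embed (std_stereo L) = stereo (wp R m) (wpstar R m) L.
Proof.
by move=> /(stereo_polar standard_pole_pair); exact: embed_rsubmx.
Qed.

Lemma embedK : cancel (@embed R m) rsubmx.
Proof. by move=> X; rewrite /embed row_mxKr. Qed.

Lemma std_stereo_invK X : std_stereo (std_stereo_inv X) = X.
Proof.
rewrite /std_stereo /std_stereo_inv stereo_invK ?embedK //.
  exact: standard_pole_pair.
exact: polar_embed.
Qed.

Lemma std_stereo_inv_domain X : pole_domain (wp R m) (std_stereo_inv X).
Proof. exact: (stereo_inv_domain standard_pole_pair (polar_embed X)). Qed.

Lemma std_stereoK L : pole_domain (wp R m) L -> std_stereo_inv (std_stereo L) = L.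
Proof.
move=> PL; rewrite /std_stereo_inv embed_std_stereo //.
exact: (stereoK standard_pole_pair).
Qed.

Lemma std_stereo_bij :
  set_bij (pole_domain (wp R m)) [set: 'rV[K]_(m.+2)] (@std_stereo R m).
Proof.
split=> [//|L L' /set_mem PL /set_mem PL' LL'|X _].
  by rewrite -(std_stereoK PL) LL' std_stereoK.
by exists (std_stereo_inv X); [exact: std_stereo_inv_domain|
  exact: std_stereo_invK].
Qed.

Lemma conj_embed X : conj_row (embed X) = embed (conj_row X).
Proof. by rewrite /conj_row map_row_mx map_mx0. Qed.

Lemma sqr_subr_conj (C : numClosedFieldType) (x : C) :
  (x - x^*) ^+ 2 = - 4 * 'Im x ^+ 2.
Proof.
have xcE : x^* = 'Re x - 'i * 'Im x.
  by rewrite {1}[x]Crect conjC_rect ?Creal_Re ?Creal_Im.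
have -> : x - x^* = 'i * (2 * 'Im x) by rewrite {1}[x]Crect xcE; ring.
by rewrite exprMn sqrCi; ring.
Qed.

(** The Hermitian square of [pi^-1 X] is [8] times the sum of the squares of
    the imaginary parts of the coordinates of X. *)
Lemma quadric_plus_std_stereo_inv X :
  @quadric_plus R (2 + m.+2) (std_stereo_inv X) <-> exists j, 'Im (X 0 j) != 0.
Proof.
have PX := polar_embed X; have pq := standard_pole_pair.
rewrite quadric_plus_line (stereo_inv_hermitian pq PX) conj_embed.
have -> : embed X - embed (conj_row X) = embed (X - conj_row X).
  by rewrite /embed opp_row_mx add_row_mx oppr0 addr0.
rewrite lorentz_embed.
have -> : - 2 * dotC (X - conj_row X) (X - conj_row X) =
    8 * \sum_j 'Im (X 0 j) ^+ 2.
  rewrite /dotC !mulr_sumr; apply: eq_bigr => j _; rewrite !mxE.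
  by rewrite -expr2 sqr_subr_conj; ring.
have Im2 j : 0 <= 'Im (X 0 j) ^+ 2.
  by rewrite real_exprn_even_ge0 // Creal_Im.
split=> [[_ _]|[j Xj]].
  rewrite pmulr_rgt0 // => S0; apply/existsP; move: S0; apply: contraTT.
  rewrite negb_exists => /forallP X0; rewrite big1 ?ltxx // => j _.
  by move: (X0 j); rewrite negbK => /eqP ->; rewrite expr0n.
split; [exact: stereo_inv_formula_neq0|exact: stereo_inv_isotropic|].
rewrite pmulr_rgt0 // lt_def sumr_ge0 // andbT psumr_neq0 //.
apply/hasP; exists j; first by rewrite mem_index_enum.
by rewrite /= lt_def expf_neq0 ?Im2.
Qed.

(** Writing [embed] and its left inverse as products with matrices presents them
    as linear maps, to which [wirtinger_linear] applies. *)
Definition embed_mx : 'M[K]_(m.+2, 2 + m.+2) := row_mx 0 1%:M.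

Lemma embedE X : embed X = X *m embed_mx.
Proof. by rewrite mul_mx_row mulmx0 mulmx1. Qed.

Definition proj_mx : 'M[K]_(2 + m.+2, m.+2) := col_mx 0 1%:M.

Lemma rsubmxE (X : 'rV[K]_(2 + m.+2)) : rsubmx X = X *m proj_mx.
Proof.
by rewrite -{2}(hsubmxK X) mul_row_col mulmx0 mulmx1 add0r.
Qed.

(** Uniqueness of Wirtinger derivatives forces those of an embedded function
    to be embedded as well. *)
Lemma is_wirtinger_embed (f : K -> 'rV[K]_(m.+2)) z a b :
  is_wirtinger (fun x => embed (f x)) z a b <->
  exists a' b', [/\ a = embed a', b = embed b' & is_wirtinger f z a' b'].
Proof.
have embed_w a' b' : is_wirtinger f z a' b' ->
    is_wirtinger (fun x => embed (f x)) z (embed a') (embed b').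
  move=> /is_wirtingerP fab; apply/is_wirtingerP.
  under eq_fun do rewrite embedE.
  by rewrite !embedE; exact: (wirtinger_linear (mulmxr embed_mx) fab).
split=> [fab|[a' [b' [-> -> /embed_w//]]]].
have f'ab : is_wirtinger f z (rsubmx a) (rsubmx b).
  apply/is_wirtingerP; move/is_wirtingerP: fab => fab.
  have := wirtinger_linear (mulmxr proj_mx) fab.
  rewrite /= -!rsubmxE; apply: wirtinger_near.
  by near=> x; rewrite /= -rsubmxE embedK.
exists (rsubmx a), (rsubmx b).
have [aE bE] := is_wirtinger_uniq fab (embed_w _ _ f'ab).
by split; [exact: aE|exact: bE|exact: f'ab].
Unshelve. all: by end_near. Qed.

Variables (M : riemann_surface R) (U : set M) (X : M -> 'rV[K]_(m.+2)).

Lemma holomorphic_embed :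
  holomorphic_vec U X <-> holomorphic_vec U (@embed R m \o X).
Proof.
split=> hX c x rc cUx; have [a aX] := hX c x rc cUx.
  exists (embed a); apply/is_wirtinger_embed; exists a, 0; split=> //.
  by rewrite /embed row_mx0.
by move/is_wirtinger_embed: aX => [a' [b' [_ /esym b0 aX]]]; exists a';
  move: aX; rewrite -(embedK b') b0 raddf0.
Qed.

Lemma isotropic_embed : isotropic_vec (@dotC K (m.+2)) U X <->
  isotropic_vec (@lorentz K (2 + m.+2)) U (@embed R m \o X).
Proof.
split=> iX c x rc cUx a b.
  move/is_wirtinger_embed => [a' [b' [-> _ aX]]]; rewrite lorentz_embed.
  exact: iX aX.
move=> aX; rewrite -lorentz_embed; apply: (iX c x rc cUx _ (embed b)).
by apply/is_wirtinger_embed; exists a, b.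
Qed.

Lemma immersion_embed :
  immersion_vec U X <-> immersion_vec U (@embed R m \o X).
Proof.
have embedL (h : K) (a b : 'rV[K]_(m.+2)) :
    h *: embed a + h^* *: embed b = embed (h *: a + h^* *: b).
  by rewrite !embedE mulmxDl -!scalemxAl.
split=> mX c x rc cUx a b.
  move/is_wirtinger_embed => [a' [b' [-> -> aX]]] h; rewrite embedL => h0.
  by apply: (mX c x rc cUx _ _ aX); rewrite -[LHS]embedK h0 raddf0.
move=> aX h h0; apply: (mX c x rc cUx (embed a) (embed b)).
  by apply/is_wirtinger_embed; exists a, b.
by rewrite embedL h0 embedE mul0mx.
Qed.

Lemma isotropic_curve_embed : isotropic_curve_vec (@dotC K (m.+2)) U X <->
  isotropic_curve_vec (@lorentz K (2 + m.+2)) U (@embed R m \o X).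
Proof.
by split=> -[/holomorphic_embed hX /isotropic_embed iX /immersion_embed mX].
Qed.

End StandardPoles.

(** * Real points of holomorphic curves *)

Section NonrealPoints.
Variables (R : realType) (M : riemann_surface R) (n : nat) (U : set M).
Variable X : M -> 'rV[Cplx R]_n.
Hypothesis oU : open U.
Hypothesis hX : holomorphic_vec U X.
Let nonreal := U `&` [set x | exists j, 'Im (X x 0 j) != 0].

Lemma nonreal_open : open nonreal.
Proof.
rewrite openE => x [Ux [j Xj]]; have [c rc cx] := rs_cover x.
have [a /is_wirtingerP Xa] := hX rc (conj cx Ux).
have Xx : (X \o chart_inv c) (chart_map c x) = X x := congr1 X (chart_mapK cx).
have lim := cvg_coord (j := j) (wirtinger_continuous Xa); rewrite Xx in lim.
have near_y : \forall y \near x,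
    'Im ((X \o chart_inv c) (chart_map c y) 0 j) != 0.
  exact: (chart_map_cvg cx (near_Im_neq0 lim Xj)).
have near_yU : \forall y \near x, [/\ chart_dom c y, U y
    & 'Im ((X \o chart_inv c) (chart_map c y) 0 j) != 0].
  near=> y; split; near: y => //.
  - by apply: open_nbhs_nbhs; split=> //; exact: chart_dom_open.
  - by apply: open_nbhs_nbhs; split.
apply: filterS near_yU => y [cy Uy Xy]; split=> //; exists j.
by move: Xy; rewrite /= chart_mapK.
Unshelve. all: by end_near. Qed.

(** Where X is real, [X = conj X] and holomorphy give
    [X_z = conj (X_(conj z)) = 0], so an immersion is not real on any
    nonempty open set. *)
Lemma nonreal_dense : immersion_vec U X -> U `<=` closure nonreal.
Proof.
move=> mX x Ux A Ax; apply: contrapT => nA.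
have [c rc cx] := rs_cover x.
have realAU : \forall y \near x, (A `&` U) y.
  by apply: filterI => //; apply: open_nbhs_nbhs.
have [a aX] := hX rc (conj cx Ux).
have Xa := (iffLR (is_wirtingerP _ _ _ _)) aX.
have Xreal : \forall z \near chart_map c x,
    conj_row ((X \o chart_inv c) z) = (X \o chart_inv c) z.
  apply: filterS (chart_near cx realAU) => z [_ [Az Uz]].
  apply/rowP => j; rewrite mxE; apply/conj_Creal/Creal_ImP.
  apply: contrapT => /eqP Xj; apply: nA.
  by exists (chart_inv c z); split=> //; split=> //; exists j.
have [a0 _] := wirtinger_uniq (wirtinger_near Xreal (wirtinger_conj Xa)) Xa.
(* the immersion condition at [h = 1] *)
have /eqP : (1 : Cplx R) = 0.
  apply: (mX c x rc (conj cx Ux) _ _ aX).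
  by rewrite -a0 map_mx0 !scaler0 addr0.
by rewrite oner_eq0.
Qed.

End NonrealPoints.

(** * Poles adapted to a point *)

Section PoleChoice.
Variables (R : realType) (k : nat).

Lemma lorentz_delta (F : comNzRingType) (X : 'rV[F]_k.+2) j :
  lorentz X (delta_mx 0 j) = (-1) ^+ (val j == 0)%N * X 0 j.
Proof.
rewrite /lorentz (bigD1 j) //= big1 => [|i ij]; rewrite !mxE eqxx.
  by rewrite eqxx mulr1 addr0.
by rewrite (negPf ij) !mulr0.
Qed.

Definition light_vector (F : comNzRingType) (s : F) (j : 'I_k.+2) : 'rV[F]_k.+2 :=
  delta_mx 0 0 + s *: delta_mx 0 j.

Lemma light_vector_pole_pair (s : R) j : j != 0 -> s ^+ 2 = 1 ->
  pole_pair (light_vector s j) (light_vector (- s) j).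
Proof.
move=> j0 s2; have j0' : (val j == 0)%N = false.
  by apply/negbTE; apply: contraNneq j0 => j0; apply/eqP/val_inj.
split; rewrite lorentzDr lorentzZr !lorentz_delta /= j0' !mxE !eqxx /=;
  rewrite (negPf j0) eq_sym (negPf j0) /=.
- by rewrite expr0 expr1 -[RHS](subrr (s ^+ 2)) {2}s2; ring.
- by rewrite expr0 expr1 -[RHS](subrr (s ^+ 2)) {2}s2; ring.
- have -> : (2 : R) = 1 + s ^+ 2 by rewrite s2.
  by rewrite expr0 expr1; ring.
Qed.

(** If every [e_0 + s e_j] were orthogonal to [xi], then
    [xi_0 = xi_j = - xi_j] for all [j != 0], hence [xi = 0]. *)
Lemma exists_pole_pair (xi : 'rV[Cplx R]_k.+2) : xi != 0 ->
  exists p q : 'rV[R]_k.+2, pole_pair p q /\ lorentz xi (complexify p) != 0.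
Proof.
move=> xi0; apply: contrapT => none.
have light0 (s : R) j : j != 0 -> s ^+ 2 = 1 ->
    - xi 0 0 + (real_complex R s : Cplx R) * xi 0 j = 0.
  move=> j0 s2; apply: contrapT => /eqP w0; apply: none.
  exists (light_vector s j), (light_vector (- s) j).
  split; first exact: light_vector_pole_pair.
  have -> : complexify (light_vector s j) =
      light_vector (real_complex R s : Cplx R) j.
    by rewrite /complexify map_mxD map_mxZ !map_delta_mx.
  rewrite /light_vector lorentzDr lorentzZr !lorentz_delta /= expr1 mulN1r.
  have -> : (val j == 0)%N = false.
    by apply/negbTE; apply: contraNneq j0 => j0; apply/eqP/val_inj.
  by rewrite expr0 mul1r.
have coord j : j != 0 -> xi 0 0 = 0 /\ xi 0 j = 0.
  move=> j0; have := light0 1 j j0 (expr1n _ _).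
  have sqN1 : (- 1 : R) ^+ 2 = 1 by rewrite sqrrN expr1n.
  have := light0 (- 1) j j0 sqN1.
  rewrite rmorphN1 rmorph1 mulN1r mul1r; move: (xi 0 0) (xi 0 j) => u v uv vu.
  have u0 : u = 0.
    have : u *+ 2 = - ((- u + v) + (- u - v)) by ring.
    by rewrite uv vu addr0 oppr0 => /eqP; rewrite mulrn_eq0 /= => /eqP.
  by split=> //; move: vu; rewrite u0 oppr0 add0r.
move/eqP : xi0; apply; apply/rowP => j; rewrite mxE.
have [->|j0] := eqVneq j 0; last by have [] := coord j j0.
by have [] := coord 1 (oner_neq0 _).
Qed.

End PoleChoice.

(** * The correspondence *)

Theorem theorem6p3 (R : realType) (m : nat) (M : riemann_surface R) :
  (* the poles are light-like with product -2, and C^(m+2) is their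
     orthogonal complement *)
  [/\ pole_pair (wp R m) (wpstar R m)
    & range (@embed R m) = polar_complement (wp R m) (wpstar R m)]
  /\
  (* the formula defining pi depends only on [xi] and takes its values in
     C^(m+2) *)
  (forall xi : 'rV[Cplx R]_(2 + m.+2),
     lorentz xi xi = 0 -> lorentz xi (complexify (wp R m)) != 0 ->
     embed (std_stereo <[xi]>%VS) = stereo_formula (wp R m) (wpstar R m) xi)
  /\
  (* pi and the stated inverse are mutually inverse bijections between the
     domain of pi and C^(m+2); pi^-1 X lies in Q_+ iff X is not real *)
  [/\ forall X : 'rV[Cplx R]_(m.+2),
        stereo_inv_formula (wp R m) (wpstar R m) (embed X) != 0,
      pole_domain (wp R m) `<=` @quadric R (2 + m.+2),
      set_bij (pole_domain (wp R m)) [set: 'rV[Cplx R]_(m.+2)]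
        (@std_stereo R m),
      forall X : 'rV[Cplx R]_(m.+2),
        pole_domain (wp R m) (std_stereo_inv X) /\
        std_stereo (std_stereo_inv X) = X
    & forall X : 'rV[Cplx R]_(m.+2),
        @quadric_plus R (2 + m.+2) (std_stereo_inv X) <->
        exists j, 'Im (X 0 j) != 0]
  /\
  (* pi maps holomorphic 1-isotropic curves in Q_+ to holomorphic 1-isotropic
     curves in C^(m+2), wherever it is defined *)
  (forall (U : set M) (G : M -> {vspace 'rV[Cplx R]_(2 + m.+2)}),
     open U -> (forall x, U x -> @quadric_plus R (2 + m.+2) (G x)) ->
     isotropic_curve_CP U G ->
     open (U `&` G @^-1` pole_domain (wp R m)) /\
     isotropic_curve_vec (@dotC (Cplx R) (m.+2))
       (U `&` G @^-1` pole_domain (wp R m)) (@std_stereo R m \o G))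
  /\
  (* under pi^-1, holomorphic 1-isotropic functions in C^(m+2) correspond to
     holomorphic 1-isotropic maps into the quadric, and immersions to
     immersions *)
  (forall (U : set M) (X : M -> 'rV[Cplx R]_(m.+2)),
     open U ->
     ((holomorphic_vec U X /\ isotropic_vec (@dotC (Cplx R) (m.+2)) U X) <->
      (holomorphic_CP U (@std_stereo_inv R m \o X) /\
       isotropic_CP U (@std_stereo_inv R m \o X))) /\
     (holomorphic_vec U X ->
      (immersion_vec U X <-> immersion_CP U (@std_stereo_inv R m \o X))))
  /\
  (* for a holomorphic 1-isotropic curve X in C^(m+2), the curve pi^-1 X lies
     in Q_+ on a dense open set *)
  (forall (U : set M) (X : M -> 'rV[Cplx R]_(m.+2)),
     open U -> isotropic_curve_vec (@dotC (Cplx R) (m.+2)) U X ->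
     let V := U `&` [set x | @quadric_plus R (2 + m.+2)
                               (std_stereo_inv (X x))] in
     [/\ open V, U `<=` closure V
       & isotropic_curve_CP V (@std_stereo_inv R m \o X)])
  /\
  (* one-to-one correspondence of curves for the fixed poles *)
  set_bij
    [set G : M -> {vspace 'rV[Cplx R]_(2 + m.+2)} |
      (forall x, @quadric_plus R (2 + m.+2) (G x) /\
                 pole_domain (wp R m) (G x)) /\
      isotropic_curve_CP setT G]
    [set X : M -> 'rV[Cplx R]_(m.+2) |
      (forall x, @quadric_plus R (2 + m.+2) (std_stereo_inv (X x))) /\
      isotropic_curve_vec (@dotC (Cplx R) (m.+2)) setT X]
    (fun G => @std_stereo R m \o G)
  /\
  (* any other choice of poles p, q gives such a correspondence, with
     {p, q}^perp in place of C^(m+2) *)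
  (forall p q : 'rV[R]_(2 + m.+2), pole_pair p q ->
     set_bij
       [set G : M -> {vspace 'rV[Cplx R]_(2 + m.+2)} |
         (forall x, @quadric_plus R (2 + m.+2) (G x) /\
                    pole_domain p (G x)) /\
         isotropic_curve_CP setT G]
       [set X : M -> 'rV[Cplx R]_(2 + m.+2) |
         (forall x, polar_complement p q (X x) /\
                    @quadric_plus R (2 + m.+2) (stereo_inv p q (X x))) /\
         isotropic_curve_vec (@lorentz (Cplx R) (2 + m.+2)) setT X]
       (fun G => stereo p q \o G) /\
     (forall G : M -> {vspace 'rV[Cplx R]_(2 + m.+2)},
        (forall x, pole_domain p (G x)) ->
        stereo_inv p q \o (stereo p q \o G) = G))
  /\
  (* every curve in Q_+ is, near any of its points, in the domain of the
     projection for a suitable choice of poles *)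
  (forall G : M -> {vspace 'rV[Cplx R]_(2 + m.+2)},
     (forall x, @quadric_plus R (2 + m.+2) (G x)) ->
     isotropic_curve_CP setT G ->
     forall x, exists p q, pole_pair p q /\
     exists U : set M,
       [/\ open U, U x, forall y, U y -> pole_domain p (G y),
           forall y, U y -> polar_complement p q (stereo p q (G y))
         & isotropic_curve_vec (@lorentz (Cplx R) (2 + m.+2)) U
             (stereo p q \o G)]).
Proof.
have pq := standard_pole_pair R m.
split; first by split; [exact: pq | exact: range_embed].
split.
  move=> xi xi0 w0; have xi_neq0 : xi != 0.
    by apply: contraNneq w0 => ->; rewrite lorentz0l.
  rewrite embed_std_stereo; last by apply/pole_domain_line.
  exact: stereo_line.
split.
  split.
  - by move=> X; apply: (stereo_inv_formula_neq0 pq); exact: polar_embed.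
  - move=> _ [xi [xi0 w0] <-]; exists xi; last by [].
    by split=> //; apply: contraNneq w0 => ->; rewrite lorentz0l.
  - exact: std_stereo_bij.
  - by move=> X; split; [exact: std_stereo_inv_domain|exact: std_stereo_invK].
  - exact: quadric_plus_std_stereo_inv.
split.
  move=> U G oU GQ iG; have [hG _ _] := iG.
  have oV := pole_domain_open (wp R m) oU GQ hG; split; first exact: oV.
  have VU : U `&` G @^-1` pole_domain (wp R m) `<=` U by move=> x [].
  have VP x : (U `&` G @^-1` pole_domain (wp R m)) x -> pole_domain (wp R m) (G x).
    by case.
  apply/isotropic_curve_embed.
  have := stereo_isotropic_curve pq VP (isotropic_curve_CP_sub oV VU iG).
  apply: isotropic_curve_vec_ext oV _ => x /VP GP.
  by rewrite /= embed_std_stereo.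
have YP (X : M -> 'rV[Cplx R]_(m.+2)) x :
    polar_complement (wp R m) (wpstar R m) ((@embed R m \o X) x).
  exact: polar_embed.
split.
  move=> U X oU; have iso := stereo_inv_isotropic_curves pq (YP X) oU.
  have imm := stereo_inv_immersion pq (YP X) oU; split.
  - split=> [[hX iX]|/iso[hX iX]]; last first.
      by split; [exact/holomorphic_embed | exact/isotropic_embed].
    apply: (iffLR iso); split; first exact: (iffLR (holomorphic_embed U X)).
    exact: (iffLR (isotropic_embed U X)).
  - move=> /holomorphic_embed hX.
    exact: iff_trans (immersion_embed U X) (imm hX).
have curve_inv (U : set M) (X : M -> 'rV[Cplx R]_(m.+2)) :
    open U -> isotropic_curve_vec (@dotC (Cplx R) (m.+2)) U X ->
    isotropic_curve_CP U (@std_stereo_inv R m \o X).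
  move=> oU /(iffLR (isotropic_curve_embed U X)) iX.
  exact: (stereo_inv_isotropic_curve pq (YP X) oU iX).
split.
  move=> U X oU iX V; have [hX _ mX] := iX.
  have VE : V = U `&` [set x | exists j, 'Im (X x 0 j) != 0].
    by apply/seteqP; split=> x [Ux /quadric_plus_std_stereo_inv].
  have oV : open V by rewrite VE; exact: nonreal_open.
  split; first exact: oV.
    by rewrite VE; exact: nonreal_dense.
  apply: curve_inv oV _; apply: isotropic_curve_vec_sub iX.
  by move=> x [].
split.
  have GE (G : M -> {vspace 'rV[Cplx R]_(2 + m.+2)}) :
      (forall x, pole_domain (wp R m) (G x)) ->
      @std_stereo_inv R m \o (@std_stereo R m \o G) = G.
    by move=> GP; apply/funext => x; exact: std_stereoK.
  split.
  - move=> G [GQ iG]; have GP x : pole_domain (wp R m) (G x) := (GQ x).2.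
    split; first by move=> x; rewrite /= std_stereoK //; exact: (GQ x).1.
    apply/isotropic_curve_embed.
    have := stereo_isotropic_curve pq (fun x _ => GP x) iG.
    apply: isotropic_curve_vec_ext openT _ => x _.
    by rewrite /= embed_std_stereo.
  - move=> G G' /set_mem[GQ _] /set_mem[GQ' _] GG'.
    apply: etrans (esym (GE _ (fun x => (GQ x).2))) _.
    apply: etrans (GE _ (fun x => (GQ' x).2)).
    exact: (congr1 (fun X => @std_stereo_inv R m \o X) GG').
  - move=> X [XQ iX]; exists (@std_stereo_inv R m \o X); last first.
      by apply/funext => x; exact: std_stereo_invK.
    split; last exact: curve_inv openT iX.
    by move=> x; split; [exact: XQ|exact: std_stereo_inv_domain].
split.
  move=> p q pq'; split; first exact: stereo_bij_curves.
  by move=> G GP; exact: stereo_comp.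
move=> G GQ iG x; have [hG _ _] := iG.
have [xi [xi0 xixi _] GxE] := GQ x.
have [p [q [pq' w0]]] := exists_pole_pair xi0.
exists p, q; split; first exact: pq'.
pose U : set M := [set: M] `&` G @^-1` pole_domain p.
have UP y : U y -> pole_domain p (G y) by case.
have oU : open U by apply: pole_domain_open openT _ hG => y _.
exists U; split; first exact: oU.
- split=> //; rewrite /preimage /= -GxE; exact/pole_domain_line.
- exact: UP.
- by move=> y /UP; exact: stereo_polar.
- apply: (stereo_isotropic_curve pq' UP).
  by apply: isotropic_curve_CP_sub oU _ iG => y _.
Qed.
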